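(* The semi-discrete fixed-stress split method with parameter $L$ defined in the context converges for any $L \ge \dfrac{\alpha^2}{2\left(\frac{2G}{d}+\lambda\right)}$. Moreover, with $\delta p_h^i(t) = p_h^i(t)-p_h^{i-1}(t)$ ($i\ge 1$) denoting the difference between two successive pressure approximations, there holds, for $t\in(0,T]$ and $i\ge 2$, $$\int_0^t \| \partial_t \delta p_h^i(s) \|^2 \, \mathrm{d} s \;\le\; \frac{L}{\frac{1}{\beta}+L}\int_0^t \| \partial_t \delta p_h^{i-1}(s) \|^2 \, \mathrm{d} s .$$
   Context: Setting. $\Omega\subset\mathbb{R}^d$, $d\le 3$, is a bounded open set with regular boundary $\Gamma=\Gamma_t\cup\Gamma_c$, where $\Gamma_t,\Gamma_c$ are disjoint and have non-null measure; $T>0$. Physical parameters: Lamé coefficients $G>0$ and $\lambda\ge 0$, Biot coefficient $\alpha>0$, Biot modulus $\beta>0$, fluid viscosity $\mu_f>0$, absolute permeability tensor $\boldsymbol{K}$ (symmetric positive definite), bulk density $\rho$, fluid density $\rho_f$, gravity vector $\boldsymbol{g}$. $(\cdot,\cdot)$ and $\|\cdot\|$ are the $L_2(\Omega)$ inner product and norm. Spaces: $\boldsymbol{V}=\{\boldsymbol{u}\in (H^1(\Omega))^d : \boldsymbol{u}|_{\Gamma_c}=\boldsymbol{0}\}$, $Q=\{p\in H^1(\Omega): p|_{\Gamma_t}=0\}$, and $\boldsymbol{V}_h\subset\boldsymbol{V}$, $Q_h\subset Q$ are finite element subspaces. Bilinear forms, with $\boldsymbol{\varepsilon}(\boldsymbol{u})=\frac12(\nabla\boldsymbol{u}+\nabla\boldsymbol{u}^t)$: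 $$a(\boldsymbol{u},\boldsymbol{v})=2G\int_\Omega \boldsymbol{\varepsilon}(\boldsymbol{u}):\boldsymbol{\varepsilon}(\boldsymbol{v})\,\mathrm{d}\Omega+\lambda\int_\Omega \operatorname{div}\boldsymbol{u}\,\operatorname{div}\boldsymbol{v}\,\mathrm{d}\Omega,\qquad b(p,q)=\int_\Omega \frac{\boldsymbol{K}}{\mu_f}\nabla p\cdot\nabla q\,\mathrm{d}\Omega .$$ Semi-discretized Biot problem: for each $t\in(0,T]$ find $(\boldsymbol{u}_h(t),p_h(t))\in\boldsymbol{V}_h\times Q_h$ such that $$a(\boldsymbol{u}_h(t),\boldsymbol{v}_h)-\alpha(p_h(t),\operatorname{div}\boldsymbol{v}_h)=(\rho\boldsymbol{g},\boldsymbol{v}_h)\quad\forall\,\boldsymbol{v}_h\in\boldsymbol{V}_h,$$ $$\alpha(\operatorname{div}\partial_t\boldsymbol{u}_h(t),q_h)+\tfrac1\beta(\partial_t p_h(t),q_h)+b(p_h(t),q_h)=(f_h,q_h)+(\boldsymbol{K}\mu_f^{-1}\rho_f\boldsymbol{g},\nabla q_h)\quad\forall\,q_h\in Q_h,$$ with a given source $f_h$; $(\boldsymbol{u}_0,p_0)$ denotes the values of displacement and pressure at $t=0$ specified by the initial condition. Semi-discrete fixed-stress split method with parameter $L$: given an initial guess $(\boldsymbol{u}_h^0(t),p_h^0(t))$ defined along the whole time interval (a natural choice is the constant one $(\boldsymbol{u}_h^0(t),p_h^0(t))=(\boldsymbol{u}_0,p_0)$, $t\in(0,T]$), the method gives a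 sequence of approximations $(\boldsymbol{u}_h^i(t),p_h^i(t))$, $i\ge1$, as follows. Step 1: given $(\boldsymbol{u}_h^{i-1}(t),p_h^{i-1}(t))\in\boldsymbol{V}_h\times Q_h$, find $p_h^i(t)\in Q_h$, with initial value $p_h^i(0)=p_0$, such that $$\left(\tfrac1\beta+L\right)(\partial_t p_h^i(t),q_h)+b(p_h^i(t),q_h)+\alpha(\operatorname{div}\partial_t\boldsymbol{u}_h^{i-1}(t),q_h)=L(\partial_t p_h^{i-1}(t),q_h)+(f_h,q_h)+(\boldsymbol{K}\mu_f^{-1}\rho_f\boldsymbol{g},\nabla q_h)\quad\forall\,q_h\in Q_h.$$ Step 2: given $p_h^i(t)\in Q_h$, find $\boldsymbol{u}_h^i(t)\in\boldsymbol{V}_h$ such that $$a(\boldsymbol{u}_h^i(t),\boldsymbol{v}_h)=\alpha(p_h^i(t),\operatorname{div}\boldsymbol{v}_h)+(\rho\boldsymbol{g},\boldsymbol{v}_h)\quad\forall\,\boldsymbol{v}_h\in\boldsymbol{V}_h.$$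
   Formalization: The estimate for i = 2 is stated only for initial guesses that are constant in time or satisfy the time-differentiated mechanics equation (it fails for an arbitrary guess); for i ≥ 3 it is stated for every initial guess. *)

(* Defs.v *)
From HB Require Import structures.
From mathcomp Require Import all_boot all_order all_algebra.
From mathcomp Require Import all_classical all_reals all_analysis.

Set Implicit Arguments.
Unset Strict Implicit.
Unset Printing Implicit Defensive.

Import Order.TTheory GRing.Theory Num.Theory.
Import numFieldNormedType.Exports.

Local Open Scope classical_set_scope.
Local Open Scope ring_scope.

(* Product sigma-algebra on 'rV[R]_n: the one generated by the coordinates,
   as for n.-tuple R in the library. *)
Section rV_measurable.
Context {R : realType}.
Variable n : nat.

Definition rV_coord (i : 'I_n) (x : 'rV[R]_n) : measurableTypeR R := x ord0 i.

Let rV_set0 : g_sigma_preimage rV_coord set0.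
Proof. exact: sigma_algebra0. Qed.

Let rV_setC A : g_sigma_preimage rV_coord A -> g_sigma_preimage rV_coord (~` A).
Proof. exact: sigma_algebraC. Qed.

Let rV_bigcup (F : (set 'rV[R]_n)^nat) :
  (forall i, g_sigma_preimage rV_coord (F i)) ->
  g_sigma_preimage rV_coord (\bigcup_i (F i)).
Proof. exact: sigma_algebra_bigcup. Qed.

HB.instance Definition _ := @isMeasurable.Build default_measure_display
  'rV[R]_n (g_sigma_preimage rV_coord) rV_set0 rV_setC rV_bigcup.

Lemma measurable_rV_coord (i : 'I_n) : measurable_fun setT (rV_coord i).
Proof.
move=> _ A mA; apply: sub_sigma_algebra; rewrite setTI.
by rewrite (bigD1 i)//=; left; exists A => //; rewrite setTI.
Qed.

Lemma measurable_fun_rVP d (S : measurableType d) (f : S -> 'rV[R]_n) :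
  (forall i, measurable_fun setT (rV_coord i \o f)) -> measurable_fun setT f.
Proof.
move=> mf _ A mA; rewrite setTI.
have : g_sigma_preimage (fun i => rV_coord i \o f) `<=` measurable.
  apply: smallest_sub; first exact: sigma_algebra_measurable.
  elim/big_ind : _ => [|X Y sX sY|i _]; first exact: sub0set.
    by rewrite subUset.
  by move=> B [C mC <-]; exact: mf.
rewrite g_sigma_preimage_comp; apply.
by exists A => //; rewrite setTI.
Qed.

End rV_measurable.

Lemma product_sigma_finite d1 d2 (T1 : measurableType d1)
    (T2 : measurableType d2) (R : realType)
    (m1 : {sigma_finite_measure set T1 -> \bar R})
    (m2 : {sigma_finite_measure set T2 -> \bar R}) :
  sigma_finite setT (m1 \x m2)%E.
Proof.
have /sigma_finiteP[F [TF ndF Foo]] := sigma_finiteT m1.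
have /sigma_finiteP[G [TG ndG Goo]] := sigma_finiteT m2.
exists (fun n => F n `*` G n).
  rewrite -setXTT TF TG predeqE => -[x y]; split.
    move=> [/= [n _ Fnx] [k _ Gky]]; exists (maxn n k) => //; split.
    - by move: x Fnx; exact/subsetPset/ndF/leq_maxl.
    - by move: y Gky; exact/subsetPset/ndG/leq_maxr.
  by move=> [n _ []/= ? ?]; split; exists n.
move=> k; have [? ?] := Foo k; have [? ?] := Goo k.
split; first exact: measurableX.
by rewrite product_measure1E// lte_mul_pinfty// ge0_fin_numE.
Qed.

Section lebesgue_rV.
Context {R : realType}.

Definition cons_rV (n : nat) (x : R * 'rV[R]_n) : 'rV[R]_n.+1 :=
  \row_i (if unlift ord0 i is Some j then x.2 ord0 j else x.1).

Definition uncons_rV (n : nat) (x : 'rV[R]_n.+1) : R * 'rV[R]_n :=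
  (x ord0 ord0, \row_j x ord0 (lift ord0 j)).

Lemma cons_rVK n : cancel (@cons_rV n) (@uncons_rV n).
Proof.
move=> [a v]; rewrite /uncons_rV !mxE unlift_none /=; congr pair.
by apply/rowP => j; rewrite !mxE liftK.
Qed.

Lemma measurable_cons_rV n :
  measurable_fun [set: measurableTypeR R * 'rV[R]_n] (@cons_rV n).
Proof.
apply: measurable_fun_rVP => i.
case: (unliftP ord0 i) => [j ->|->].
- rewrite (_ : _ \o _ = rV_coord j \o snd); last first.
    by apply/funext => -[a v] /=; rewrite /rV_coord mxE liftK.
  by apply: measurableT_comp => //; exact: measurable_rV_coord.
- rewrite (_ : _ \o _ = fst) //.
  by apply/funext => -[a v] /=; rewrite /rV_coord mxE unlift_none.
Qed.

Lemma measurable_uncons_rV n :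
  measurable_fun [set: 'rV[R]_n.+1]
    (@uncons_rV n : _ -> measurableTypeR R * 'rV[R]_n).
Proof.
apply: measurable_fun_pair; first exact: (measurable_rV_coord ord0).
apply: measurable_fun_rVP => i.
rewrite (_ : _ \o _ = rV_coord (lift ord0 i)); first exact: measurable_rV_coord.
by apply/funext => x; rewrite /rV_coord /= mxE.
Qed.

Section step.
Variables (n : nat) (mu : {sigma_finite_measure set 'rV[R]_n -> \bar R}).

Definition lebesgue_rV_step : set 'rV[R]_n.+1 -> \bar R :=
  pushforward (@lebesgue_measure R \x mu)%E (@cons_rV n).

Let step0 : lebesgue_rV_step set0 = 0%E.
Proof. by rewrite /lebesgue_rV_step /pushforward preimage_set0 measure0. Qed.

Let step_ge0 A : (0 <= lebesgue_rV_step A)%E.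
Proof. by rewrite /lebesgue_rV_step /pushforward; exact: measure_ge0. Qed.

Let mpreimage A : measurable A ->
  measurable (@cons_rV n @^-1` A : set (measurableTypeR R * 'rV[R]_n)).
Proof.
by move=> mA; rewrite -[X in measurable X]setTI; exact: measurable_cons_rV.
Qed.

Let step_sigma_additive : semi_sigma_additive lebesgue_rV_step.
Proof.
move=> F mF tF mUF; rewrite /lebesgue_rV_step /pushforward preimage_bigcup.
apply: measure_semi_sigma_additive.
- by move=> k; exact: mpreimage.
- apply/trivIsetP => /= i j _ _ ij; rewrite -preimage_setI.
  by move/trivIsetP : tF => /(_ _ _ _ _ ij) ->//; rewrite preimage_set0.
- by rewrite -preimage_bigcup; exact: mpreimage.
Qed.

HB.instance Definition _ := isMeasure.Build _ _ _ lebesgue_rV_step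
  step0 step_ge0 step_sigma_additive.

Let step_sigma_finite : sigma_finite setT lebesgue_rV_step.
Proof.
have [F TF Foo] : sigma_finite setT (@lebesgue_measure R \x mu)%E.
  exact: product_sigma_finite.
exists (fun k => @uncons_rV n @^-1` F k).
  by rewrite -preimage_bigcup -TF preimage_setT.
move=> k; have [mF ltF] := Foo k; split.
  by rewrite -[X in measurable X]setTI; exact: measurable_uncons_rV.
rewrite /lebesgue_rV_step /pushforward (_ : _ @^-1` _ = F k)//.
by apply/seteqP; split => x /=; rewrite cons_rVK.
Qed.

HB.instance Definition _ := @Measure_isSigmaFinite.Build _ _ _
  lebesgue_rV_step step_sigma_finite.

End step.

Fixpoint lebesgue_rV (n : nat) :
    {sigma_finite_measure set 'rV[R]_n -> \bar R} :=
  match n with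
  | 0 => @dirac _ 'rV[R]_0 0 R
  | n.+1 => lebesgue_rV_step (lebesgue_rV n)
  end.

Lemma lebesgue_rV_box n (A : 'I_n -> set (measurableTypeR R)) :
  (forall i, measurable (A i)) ->
  lebesgue_rV n [set x | forall i, A i (x ord0 i)] =
  (\prod_(i < n) @lebesgue_measure R (A i))%E.
Proof.
elim: n A => [|n IH] A mA.
  by rewrite big_ord0 /= diracE mem_set// => -[].
rewrite big_ord_recl /= -IH// /lebesgue_rV_step /pushforward.
rewrite -product_measure1E//.
- congr product_measure1; apply/seteqP; split=> -[a v] /=.
  + move=> H; split; first by have := H ord0; rewrite mxE unlift_none.
    by move=> i; have := H (lift ord0 i); rewrite mxE liftK.
  + move=> [Aa Av] i; rewrite mxE.
    by case: unliftP => [j ->|->].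
- rewrite [X in measurable X](_ : _ =
    \bigcap_(i in [set: 'I_n]) (rV_coord i @^-1` A (lift ord0 i))).
    apply: fin_bigcap_measurable => // i _.
    by rewrite -[X in measurable X]setTI; exact: measurable_rV_coord.
  apply/seteqP; split=> x /= H i; first by move=> _; exact: H.
  exact: (H i).
Qed.

End lebesgue_rV.

Section geometry.
Context {R : realType} {d : nat}.
Local Notation X := 'rV[R]_d.
Implicit Types (x y : X) (A Omega : set X).

(* The norm carried by 'rV[R]_d in the library is the sup norm. *)
Definition dotp x y : R := \sum_(i < d) x ord0 i * y ord0 i.
Definition enorm x : R := Num.sqrt (dotp x x).
Definition eball x (r : R) : set X := [set y | enorm (y - x) < r].

Definition ediam A : \bar R :=
  ereal_sup [set (enorm (x - y))%:E | x in A & y in A].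

(* Hausdorff measure of dimension s, up to the usual normalising constant.
   The empty set is singled out because 0 ^+ 0 = 1 and ediam set0 = -oo. *)
Definition hausdorff_weight (s : nat) A : \bar R :=
  if `[< A = set0 >] then 0%E else (fine (ediam A) ^+ s)%:E.

Definition hausdorff_pre (s : nat) (delta : R) A : \bar R :=
  ereal_inf [set (\sum_(0 <= k <oo) hausdorff_weight s (F k))%E |
    F in [set F : (set X)^nat |
      (forall k, (ediam (F k) <= delta%:E)%E) /\ A `<=` \bigcup_k F k]].

Definition hausdorff (s : nat) A : \bar R :=
  ereal_sup [set hausdorff_pre s delta A | delta in [set delta | 0 < delta]].

Definition bdry Omega : set X := closure Omega `\` interior Omega.

(* Near each boundary point, Omega is the region strictly above the graph of a
   Lipschitz function h over the hyperplane orthogonal to a unit vector e. *)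
Definition lipschitz_boundary Omega : Prop :=
  forall x, bdry Omega x ->
  exists (U : set X) (e : X) (h : X -> R) (M : R),
    [/\ open U, U x, enorm e = 1,
        (forall y z, `|h y - h z| <= M * enorm (y - z)) &
        forall y, U y -> (Omega y <-> h (y - dotp y e *: e) < dotp y e)].

End geometry.

Section sobolev.
Context {R : realType} {d : nat}.
Local Notation X := 'rV[R]_d.
Variable Omega : set X.

Definition partial (j : 'I_d) (f : X -> R) : X -> R :=
  fun x => 'D_(delta_mx ord0 j) f x.

Definition smooth (f : X -> R) : Prop :=
  forall (s : seq 'I_d) (x : X), differentiable (foldr partial f s) x.

Definition test_function (f : X -> R) : Prop :=
  smooth f /\
  exists C : set X, [/\ compact C, C `<=` Omega & forall x, ~ C x -> f x = 0].

Definition L2 (f : X -> R) : Prop :=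
  measurable_fun Omega f /\
  (lebesgue_rV d).-integrable Omega (EFin \o (fun x => f x ^+ 2)).

Definition ip (f g : X -> R) : R :=
  \int[lebesgue_rV d]_(x in Omega) (f x * g x).

(* A function bundled with a representative of its weak gradient: elements of
   H1 below are such pairs, so that no choice of representative is needed to
   evaluate the bilinear forms. *)
Record wfun := Wfun { val : X -> R; grad : 'I_d -> X -> R }.

Definition H1 (w : wfun) : Prop :=
  [/\ L2 (val w), forall j, L2 (grad w j) &
      forall j f, test_function f ->
        ip (val w) (partial j f) = - ip (grad w j) f].

(* Zero trace on G: at almost every point x of G for the surface measure, the
   mean of |f| over the part of Omega within distance r of x tends to 0 as
   r -> 0. For a Lipschitz domain this is the pointwise description of the
   trace of a Sobolev function. *)
Definition zero_trace (G : set X) (f : X -> R) : Prop :=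
  hausdorff d.-1 [set x | G x /\
    ~ ((fun r : R => (fine (lebesgue_rV d (Omega `&` eball x r)))^-1 *
          \int[lebesgue_rV d]_(y in Omega `&` eball x r) `|f y|)
       @ 0^'+ --> (0 : R))] = 0%E.

Definition vfun := 'I_d -> wfun.

Definition in_Q (Gt : set X) (q : wfun) : Prop :=
  H1 q /\ zero_trace Gt (val q).
Definition in_V (Gc : set X) (v : vfun) : Prop :=
  forall l, H1 (v l) /\ zero_trace Gc (val (v l)).

Definition wcomb n (psi : 'I_n -> wfun) (c : 'I_n -> R) : wfun :=
  Wfun (fun x => \sum_(k < n) c k * val (psi k) x)
       (fun j x => \sum_(k < n) c k * grad (psi k) j x).
Definition vcomb n (phi : 'I_n -> vfun) (c : 'I_n -> R) : vfun :=
  fun l => wcomb (fun k => phi k l) c.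

Definition wsub (v w : wfun) : wfun :=
  Wfun (fun x => val v x - val w x) (fun j x => grad v j x - grad w j x).
Definition vsub (v w : vfun) : vfun := fun l => wsub (v l) (w l).

Definition div (v : vfun) : X -> R := fun x => \sum_(l < d) grad (v l) l x.
Definition strain (v : vfun) (i j : 'I_d) : X -> R :=
  fun x => (grad (v i) j x + grad (v j) i x) / 2.

Definition L2sq (q : wfun) : R := ip (val q) (val q).
Definition H1sq (q : wfun) : R :=
  L2sq q + \sum_(j < d) ip (grad q j) (grad q j).
Definition H1sqv (v : vfun) : R := \sum_(l < d) H1sq (v l).

(* psi (resp. phi) is a basis of a finite-dimensional subspace Q_h of Q
   (resp. V_h of V). *)
Definition basis_in_Q (Gt : set X) m (psi : 'I_m -> wfun) : Prop :=
  (forall k, in_Q Gt (psi k)) /\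
  forall c : 'I_m -> R,
    {ae lebesgue_rV d, forall x, Omega x -> val (wcomb psi c) x = 0} ->
    forall k, c k = 0.
Definition basis_in_V (Gc : set X) n (phi : 'I_n -> vfun) : Prop :=
  (forall k, in_V Gc (phi k)) /\
  forall c : 'I_n -> R,
    (forall l,
      {ae lebesgue_rV d, forall x, Omega x -> val (vcomb phi c l) x = 0}) ->
    forall k, c k = 0.

End sobolev.

(* Continuously differentiable coefficient vectors on [0, T]; dcoef is the
   derivative, extended by continuity to the endpoints. Values outside [0, T]
   are irrelevant. *)
Record c1curve (R : realType) (T : R) (n : nat) := C1curve {
  coef : 'I_n -> R -> R;
  dcoef : 'I_n -> R -> R;
  _ : forall k, {within `[0, T], continuous (coef k)};
  _ : forall k, {within `[0, T], continuous (dcoef k)};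
  _ : forall k t, 0 < t < T -> is_derive t (1 : R) (coef k) (dcoef k t) }.

Record biot_params (R : realType) (d : nat) := BiotParams {
  shear : R;      (* G *)
  lame : R;       (* lambda *)
  alpha : R;
  beta : R;
  visc : R;       (* mu_f *)
  perm : 'rV[R]_d -> 'M[R]_d;   (* K *)
  rho : R;
  rhof : R;
  gravity : 'rV[R]_d }.

Definition admissible (R : realType) (d : nat) (Omega : set 'rV[R]_d)
    (P : biot_params R d) : Prop :=
  [/\ 0 < shear P, 0 <= lame P, 0 < alpha P, 0 < beta P & 0 < visc P] /\
  [/\ forall i j, measurable_fun Omega (fun x => perm P x i j),
      exists M : R, forall x i j, Omega x -> `|perm P x i j| <= M,
      forall x, Omega x -> (perm P x)^T = perm P x &
      forall x (xi : 'cV[R]_d), Omega x -> xi != 0 ->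
        0 < (xi^T *m perm P x *m xi) ord0 ord0].

Section biot.
Context {R : realType} {d : nat}.
Local Notation X := 'rV[R]_d.
Variables (Omega : set X) (P : biot_params R d) (T : R).
Variables (n m : nat) (phi : 'I_n -> @vfun R d) (psi : 'I_m -> @wfun R d).
Variable f : R -> X -> R.

Local Notation "( f , g )" := (ip Omega f g).

Definition aform (u v : @vfun R d) : R :=
  2 * shear P * \int[lebesgue_rV d]_(x in Omega)
      (\sum_(i < d) \sum_(j < d) strain u i j x * strain v i j x) +
  lame P * \int[lebesgue_rV d]_(x in Omega) (div u x * div v x).

Definition bform (p q : @wfun R d) : R :=
  \int[lebesgue_rV d]_(x in Omega)
    (\sum_(i < d) \sum_(j < d)
       perm P x i j / visc P * grad p j x * grad q i x).

Definition body_load (v : @vfun R d) : R :=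
  \int[lebesgue_rV d]_(x in Omega)
    (\sum_(l < d) rho P * gravity P ord0 l * val (v l) x).

Definition gravity_flux (q : @wfun R d) : R :=
  \int[lebesgue_rV d]_(x in Omega)
    (\sum_(i < d) \sum_(j < d)
       perm P x i j / visc P * rhof P * gravity P ord0 j * grad q i x).

Definition Vh : set (@vfun R d) := range (vcomb phi).
Definition Qh : set (@wfun R d) := range (wcomb psi).

(* Value and time derivative of a curve in V_h or Q_h. *)
Definition vat (u : c1curve T n) (t : R) := vcomb phi (fun k => coef u k t).
Definition vdt (u : c1curve T n) (t : R) := vcomb phi (fun k => dcoef u k t).
Definition wat (p : c1curve T m) (t : R) := wcomb psi (fun k => coef p k t).
Definition wdt (p : c1curve T m) (t : R) := wcomb psi (fun k => dcoef p k t).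

Definition biot_solution (u : c1curve T n) (p : c1curve T m) : Prop :=
  forall t, 0 < t <= T ->
  (forall v, Vh v ->
     aform (vat u t) v - alpha P * (val (wat p t), div v) = body_load v) /\
  (forall q, Qh q ->
     alpha P * (div (vdt u t), val q) + (beta P)^-1 * (val (wdt p t), val q)
       + bform (wat p t) q
     = (f t, val q) + gravity_flux q).

(* u 0 and p 0 are the initial guess. *)
Definition fixed_stress (L : R) (p0 : 'I_m -> R)
    (u : nat -> c1curve T n) (p : nat -> c1curve T m) : Prop :=
  forall i,
  (forall k, coef (p i.+1) k 0 = p0 k) /\
  forall t, 0 < t <= T ->
  (forall q, Qh q ->
     ((beta P)^-1 + L) * (val (wdt (p i.+1) t), val q)
       + bform (wat (p i.+1) t) q + alpha P * (div (vdt (u i) t), val q)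
     = L * (val (wdt (p i) t), val q) + (f t, val q) + gravity_flux q) /\
  (forall v, Vh v ->
     aform (vat (u i.+1) t) v
     = alpha P * (val (wat (p i.+1) t), div v) + body_load v).

(* The mechanics equation at t = 0 for given initial values. *)
Definition compatible_initial (u0 : 'I_n -> R) (p0 : 'I_m -> R) : Prop :=
  forall v, Vh v ->
    aform (vcomb phi u0) v - alpha P * (val (wcomb psi p0), div v)
    = body_load v.

(* The time derivative of the mechanics equation for an initial guess. It
   holds for every guess that is constant in time and for every guess obeying
   the mechanics equation. *)
Definition consistent_guess (u : c1curve T n) (p : c1curve T m) : Prop :=
  forall t, 0 < t <= T -> forall v, Vh v ->
    aform (vdt u t) v = alpha P * (val (wdt p t), div v).

Definition time_int (t : R) (h : R -> R) : R :=
  \int[lebesgue_measure]_(s in `[0, t]) h s.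

(* Convergence of the pressures uniformly in time in H1 and of their time
   derivatives in L2(0, T; L2), and of the displacements uniformly in time and
   with their time derivatives in L2(0, T) for the energy norm a(v, v)^(1/2).
   When a is definite on V_h (that is, when Step 2 is uniquely solvable) the
   displacements converge for the H1 norm as well; if Omega has a connected
   component that does not meet Gamma_c, a may fail to be definite. *)
Definition converges_to (u : nat -> c1curve T n) (p : nat -> c1curve T m)
    (us : c1curve T n) (ps : c1curve T m) : Prop :=
  forall eps : R, 0 < eps -> \forall i \near \oo,
  [/\ forall t, 0 <= t <= T ->
        H1sq Omega (wsub (wat (p i) t) (wat ps t)) <= eps,
      time_int T (fun s => L2sq Omega (wsub (wdt (p i) s) (wdt ps s))) <= eps,
      forall t, 0 <= t <= T ->
        aform (vsub (vat (u i) t) (vat us t)) (vsub (vat (u i) t) (vat us t))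
        <= eps,
      time_int T (fun s => aform (vsub (vdt (u i) s) (vdt us s))
                                 (vsub (vdt (u i) s) (vdt us s))) <= eps &
      (forall c, aform (vcomb phi c) (vcomb phi c) = 0 -> forall k, c k = 0) ->
      (forall t, 0 <= t <= T ->
         H1sqv Omega (vsub (vat (u i) t) (vat us t)) <= eps) /\
      time_int T (fun s => H1sqv Omega (vsub (vdt (u i) s) (vdt us s)))
        <= eps].

(* Time derivative of the increment p^i - p^(i-1), for i >= 1. *)
Definition dt_delta (p : nat -> c1curve T m) (i : nat) (t : R) : @wfun R d :=
  wsub (wdt (p i) t) (wdt (p i.-1) t).

End biot.

(* Main.v *)
Require Import Defs.
From HB Require Import structures.
From mathcomp Require Import all_boot all_order all_algebra.
From mathcomp Require Import all_classical all_reals all_analysis.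
From mathcomp Require Import measurable_realfun ring lra.

Set Implicit Arguments.
Unset Strict Implicit.
Unset Printing Implicit Defensive.

Import Order.TTheory GRing.Theory Num.Theory.
Import numFieldNormedType.Exports.

(* val is the value of a wfun below, not the projection of a subtype. *)
Import Defs.

Local Open Scope classical_set_scope.
Local Open Scope ring_scope.

(** Fix bases of the discrete spaces. With M, A, B the matrices of the L2 inner
    product of Q_h and of the forms a and b, and C the matrix of (div v, q), the
    problem becomes a differential system for vectors of coefficients. The
    displacement is eliminated from it. Since the divergence is the trace of
    the strain, (2 G / d + lambda) (div v, div v) <= a(v, v) (div_le_aform);
    so every v with a(v, v) = 0 is annihilated by C, the equation S A = C^T has
    a solution (schur_factor) even when A is singular, and the time derivative
    of the mechanics equation turns alpha (div u', q) into the form with matrix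
    alpha^2 S C applied to p' (mechanics_rate). By the same inequality
    0 <= alpha^2 S C <= alpha^2 / (2 G / d + lambda) M, and this is at most
    2 L M exactly by the assumption on L (coupling_mx_le).

    Hence a difference e of successive pressures, or the error of a pressure,
    satisfies (1 / beta + L) M e' + B e = (L M - alpha^2 S C) y', where y is the
    previous difference or error, and e(0) = 0. The form L M - alpha^2 S C
    lies between - L M and L M, so its value at (y', e') is at most
    L / 2 (|e'|^2 + |y'|^2) in the norm of M (coupling_le). Testing with e' and
    integrating in time, B contributes b(e(t), e(t)) / 2 >= 0, and
    (1 / beta + L / 2) times the integral of |e'|^2 is at most L / 2 times the
    integral of |y'|^2 (energy_estimate). This contracts the integrals by
    L / (2 / beta + L), which is less than L / (1 / beta + L)
    (energy_contraction).

    Convergence follows: the velocity errors decay geometrically in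
    L2(0, T; L2) (error_decay); a curve starting from 0 is controlled by its
    velocity (velocity_bound), all norms on Q_h are equivalent (pd_bf_le), and
    the displacement is controlled by the pressure in the energy norm
    (displacement_le). Existence of the semi-discrete solution is obtained from
    the iterates themselves: they form a Cauchy sequence uniformly in time, and
    the limit satisfies the system integrated in time, hence is continuously
    differentiable (solution_exists). *)

(** * Bilinear forms on coefficient vectors *)

(** The bilinear form with matrix N, on row vectors of coefficients. *)
Definition bf (R : realType) a b (N : 'M[R]_(a, b)) (x : 'rV[R]_a)
  (y : 'rV[R]_b) : R := (x *m N *m y^T) ord0 ord0.

Section bf_theory.
Variables (R : realType) (a b : nat).
Implicit Types (N : 'M[R]_(a, b)) (x : 'rV[R]_a) (y : 'rV[R]_b).

Lemma bfE N x y : bf N x y = \sum_k \sum_l x ord0 k * y ord0 l * N k l.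
Proof.
rewrite /bf mxE; under eq_bigr do rewrite mxE mulr_suml.
rewrite exchange_big; apply: eq_bigr => k _; apply: eq_bigr => l _.
by rewrite mxE mulrAC.
Qed.

Lemma bfDl N x x' y : bf N (x + x') y = bf N x y + bf N x' y.
Proof. by rewrite /bf !mulmxDl mxE. Qed.

Lemma bfDr N x y y' : bf N x (y + y') = bf N x y + bf N x y'.
Proof. by rewrite /bf linearD /= mulmxDr mxE. Qed.

Lemma bfZl N c x y : bf N (c *: x) y = c * bf N x y.
Proof. by rewrite /bf -!scalemxAl mxE. Qed.

Lemma bfZr N c x y : bf N x (c *: y) = c * bf N x y.
Proof. by rewrite /bf linearZ /= -!scalemxAr mxE. Qed.

Lemma bf0l N y : bf N 0 y = 0.
Proof. by rewrite /bf !mul0mx mxE. Qed.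

Lemma bf0r N x : bf N x 0 = 0.
Proof. by rewrite /bf trmx0 mulmx0 mxE. Qed.

Lemma bfBl N x x' y : bf N (x - x') y = bf N x y - bf N x' y.
Proof. by rewrite bfDl -scaleN1r bfZl mulN1r. Qed.

Lemma bfBr N x y y' : bf N x (y - y') = bf N x y - bf N x y'.
Proof. by rewrite bfDr -scaleN1r bfZr mulN1r. Qed.

Lemma bfDm N N' x y : bf (N + N') x y = bf N x y + bf N' x y.
Proof. by rewrite /bf mulmxDr mulmxDl mxE. Qed.

Lemma bfZm c N x y : bf (c *: N) x y = c * bf N x y.
Proof. by rewrite /bf -scalemxAr -scalemxAl mxE. Qed.

Lemma bfNm N x y : bf (- N) x y = - bf N x y.
Proof. by rewrite -scaleN1r bfZm mulN1r. Qed.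

Lemma bfBm N N' x y : bf (N - N') x y = bf N x y - bf N' x y.
Proof. by rewrite bfDm bfNm. Qed.

Lemma bf_tr N x y : bf N^T y x = bf N x y.
Proof.
rewrite /bf (_ : y *m _ *m _ = (x *m N *m y^T)^T); first by rewrite mxE.
by rewrite !trmx_mul trmxK mulmxA.
Qed.

Lemma bf_dot N x y : bf N x y = bf 1%:M (x *m N) y.
Proof. by rewrite /bf mulmx1. Qed.

End bf_theory.

Lemma bf_inj (R : realType) b (x x' : 'rV[R]_b) :
  (forall y, bf 1%:M x y = bf 1%:M x' y) -> x = x'.
Proof.
move=> h; apply/rowP => k; have := h (delta_mx ord0 k).
by rewrite /bf !mulmx1 trmx_delta -!colE !mxE.
Qed.

Lemma bfC (R : realType) a (N : 'M[R]_a) x y :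
  N^T = N -> bf N x y = bf N y x.
Proof. by move=> s; rewrite -[LHS]bf_tr s. Qed.

Lemma cvg_sum_ord (R : realType) (U : Type) (F : set_system U)
    {FF : Filter F} n (f : 'I_n -> U -> R) (l : 'I_n -> R) :
  (forall i, f i x @[x --> F] --> l i) ->
  (\sum_i f i x) @[x --> F] --> \sum_i l i.
Proof.
elim: n f l => [f l _|n IH f l cf].
  by rewrite big_ord0; under eq_fun do rewrite big_ord0; exact: cvg_cst.
rewrite big_ord_recl; under eq_fun do rewrite big_ord_recl.
by apply: cvgD; [exact: cf|apply: IH => i; exact: cf].
Qed.

(** * Calculus on the time interval *)

Section time.
Variables (R : realType) (T : R).
Hypothesis T0 : 0 < T.
Implicit Types (g h : R -> R).

(** Continuity on [0, T]; values outside are irrelevant. *)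
Definition tcont h := {within `[0, T], continuous h}.

Lemma tcont_cst c : tcont (fun=> c).
Proof. by move=> x; exact: cvg_cst. Qed.

Lemma tcontD g h : tcont g -> tcont h -> tcont (fun t => g t + h t).
Proof. by move=> cg ch x; apply: cvgD; [exact: cg|exact: ch]. Qed.

Lemma tcontM g h : tcont g -> tcont h -> tcont (fun t => g t * h t).
Proof. by move=> cg ch x; apply: cvgM; [exact: cg|exact: ch]. Qed.

Lemma tcontZ c h : tcont h -> tcont (fun t => c * h t).
Proof. by move=> ch; apply: tcontM => //; exact: tcont_cst. Qed.

Lemma tcontB g h : tcont g -> tcont h -> tcont (fun t => g t - h t).
Proof. by move=> cg ch x; apply: cvgB; [exact: cg|exact: ch]. Qed.

Lemma tcont_sum n (F : 'I_n -> R -> R) :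
  (forall i, tcont (F i)) -> tcont (fun t => \sum_i F i t).
Proof. by move=> cF x; apply: cvg_sum_ord => i; exact: cF. Qed.

Lemma tcont_eq g h : tcont g -> tcont h ->
  (forall t, 0 < t < T -> g t = h t) -> forall t, 0 <= t <= T -> g t = h t.
Proof.
move=> /(continuous_within_itvP _ T0)[_ g0 gT].
move=> /(continuous_within_itvP _ T0)[_ h0 hT] gh t.
rewrite !le_eqVlt => /andP[/predU1P[<- _|t0 /predU1P[->|tT]]].
- apply: (cvg_unique (@Rhausdorff R) g0); apply: cvg_trans h0.
  apply: near_eq_cvg; near=> x; rewrite gh//.
  have x0 : 0 < x by near: x; exact: nbhs_right_gt.
  have xT : x < T by near: x; exact: nbhs_right_lt.
  by rewrite x0.
- apply: (cvg_unique (@Rhausdorff R) gT); apply: cvg_trans hT.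
  apply: near_eq_cvg; near=> x; rewrite gh//.
  have x0 : 0 < x by near: x; exact: nbhs_left_gt.
  have xT : x < T by near: x; exact: nbhs_left_lt.
  by rewrite x0.
- by apply: gh; rewrite t0.
Unshelve. all: by end_near. Qed.

Lemma tcont_sub t h : 0 <= t <= T -> tcont h -> {within `[0, t], continuous h}.
Proof.
move=> /andP[t0 tT]; apply: continuous_subspaceW => x /=.
by rewrite !in_itv/= => /andP[-> xt]; exact: le_trans tT.
Qed.

Lemma tcont_integrable t h : 0 <= t <= T -> tcont h ->
  (@lebesgue_measure R).-integrable `[0, t] (EFin \o h).
Proof.
move=> tT ch; apply: continuous_compact_integrable;
  first exact: segment_compact.
exact: tcont_sub tT ch.
Qed.

Lemma time_intD t g h : 0 <= t <= T -> tcont g -> tcont h ->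
  time_int t (fun s => g s + h s) = time_int t g + time_int t h.
Proof. by move=> tT cg ch; rewrite /time_int RintegralD//;
  exact: tcont_integrable. Qed.

Lemma time_intB t g h : 0 <= t <= T -> tcont g -> tcont h ->
  time_int t (fun s => g s - h s) = time_int t g - time_int t h.
Proof. by move=> tT cg ch; rewrite /time_int RintegralB//;
  exact: tcont_integrable. Qed.

Lemma time_intZ t c h : 0 <= t <= T -> tcont h ->
  time_int t (fun s => c * h s) = c * time_int t h.
Proof. by move=> tT ch; rewrite /time_int RintegralZl//;
  exact: tcont_integrable. Qed.

Lemma time_int_cst t c : 0 <= t -> time_int t (fun=> c : R) = c * t.
Proof.
move=> t0; rewrite /time_int Rintegral_cst//= lebesgue_measure_itv/= lte_fin.
case: ltP => /= [_|t1]; first by rewrite subr0.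
by congr (_ * _); apply/eqP; rewrite eq_le t0 t1.
Qed.

Lemma time_int_le t g h : 0 <= t <= T -> tcont g -> tcont h ->
  (forall s, 0 <= s <= T -> g s <= h s) -> time_int t g <= time_int t h.
Proof.
move=> tT cg ch gh; apply: le_Rintegral => //; do ?exact: tcont_integrable.
move=> s /=; rewrite in_itv/= => /andP[s0 st]; apply: gh; rewrite s0/=.
by case/andP: tT => _; exact: (le_trans st).
Qed.

Lemma time_int_ge0 t h : 0 <= t <= T ->
  (forall s, 0 <= s <= T -> 0 <= h s) -> 0 <= time_int t h.
Proof.
move=> /andP[t0 tT] h0; apply: Rintegral_ge0 => s /=;
  rewrite in_itv/= => /andP[s0 st].
by apply: h0; rewrite s0 (le_trans st).
Qed.

Lemma time_int_mono t h : 0 <= t <= T -> tcont h ->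
  (forall s, 0 <= s <= T -> 0 <= h s) -> time_int t h <= time_int T h.
Proof.
move=> /andP[t0 tT] ch h0.
have TT : 0 <= T <= T by rewrite ltW//=.
rewrite -subr_ge0 /time_int Rintegral_itvB ?bnd_simp//;
  last exact: tcont_integrable.
apply: Rintegral_ge0 => s /=; rewrite in_itv/= => /andP[ts sT].
by apply: h0; rewrite sT andbT (le_trans t0)// ltW.
Qed.

Lemma time_int_FTC t g h : 0 <= t <= T -> tcont g -> tcont h ->
  (forall s, 0 < s < T -> is_derive s (1 : R) g (h s)) ->
  time_int t h = g t - g 0.
Proof.
move=> /andP[]; rewrite le_eqVlt => /predU1P[<- _ _ _ _|t0 tT cg ch dg].
  by rewrite subrr /time_int set_itv1 Rintegral_set1.
have tT' : 0 <= t <= T by rewrite ltW.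
rewrite /time_int /Rintegral (@continuous_FTC2 _ h g) //.
- exact: tcont_sub.
- have /(continuous_within_itvP _ t0)[_ g0 gt] := tcont_sub tT' cg.
  split => // s; rewrite in_itv/= => /andP[s0 st].
  by have [] : is_derive s (1 : R) g (h s) by apply: dg;
    rewrite s0 (lt_le_trans st).
- move=> s; rewrite in_itv/= => /andP[s0 st].
  rewrite derive1E; apply: (@derive_val _ _ _ _ _ _ _ (dg s _)).
  by rewrite s0 (lt_le_trans st).
Qed.

Lemma tcont_time_int h : tcont h -> tcont (fun t => time_int t h).
Proof.
move=> ch; apply: parameterized_integral_continuous; first exact: ltW.
by apply: tcont_integrable => //; rewrite ltW//=.
Qed.

Lemma is_derive_time_int h t : tcont h -> 0 < t < T ->
  is_derive t (1 : R) (fun t => time_int t h) (h t).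
Proof.
move=> ch /andP[t0 tT].
have iT : (@lebesgue_measure R).-integrable `[0, T] (EFin \o h).
  by apply: tcont_integrable => //; rewrite ltW//=.
have [|d1 d2] := continuous_FTC1_closed tT iT t0.
  move/(continuous_within_itvP _ T0): ch => [ch _ _].
  by apply: ch; rewrite in_itv/= t0.
by split; [exact: d1|rewrite -derive1E; exact: d2].
Qed.

End time.

(** * Curves of coefficient vectors *)

Section curves.
Variables (R : realType) (T : R).

(** Continuity on [0, T] of a curve, coordinate by coordinate. *)
Definition vcont a (x : R -> 'rV[R]_a) :=
  forall k, tcont T (fun t => x t ord0 k).

(** x' is the derivative of x in the interior of [0, T]. *)
Definition vderiv a (x x' : R -> 'rV[R]_a) := forall k t, 0 < t < T ->
  is_derive t (1 : R) (fun s => x s ord0 k) (x' t ord0 k).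

(** The coordinatewise integral over [0, t]. *)
Definition vint a (x : R -> 'rV[R]_a) (t : R) : 'rV[R]_a :=
  \row_k time_int t (fun s => x s ord0 k).

Lemma vcont_cst a (x : 'rV[R]_a) : vcont (fun=> x).
Proof. by move=> k; exact: tcont_cst. Qed.

Lemma vcontD a (x y : R -> 'rV[R]_a) :
  vcont x -> vcont y -> vcont (fun t => x t + y t).
Proof.
move=> cx cy k; under [X in tcont _ X]eq_fun do rewrite mxE.
exact: tcontD.
Qed.

Lemma vcontZ a c (x : R -> 'rV[R]_a) : vcont x -> vcont (fun t => c *: x t).
Proof.
move=> cx k; under [X in tcont _ X]eq_fun do rewrite mxE.
exact: tcontZ.
Qed.

Lemma vcontB a (x y : R -> 'rV[R]_a) :
  vcont x -> vcont y -> vcont (fun t => x t - y t).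
Proof.
move=> cx cy k; under [X in tcont _ X]eq_fun do rewrite !mxE.
exact: tcontB.
Qed.

Lemma vcont_mulmx a b (N : 'M[R]_(a, b)) x :
  vcont x -> vcont (fun t => x t *m N).
Proof.
move=> cx k; under [X in tcont _ X]eq_fun do rewrite mxE.
by apply: tcont_sum => i; apply: tcontM => //; exact: tcont_cst.
Qed.

Lemma tcont_bf a b (N : 'M[R]_(a, b)) x y : vcont x -> vcont y ->
  tcont T (fun t => bf N (x t) (y t)).
Proof.
move=> cx cy; under [X in tcont _ X]eq_fun do rewrite bfE.
apply: tcont_sum => k; apply: tcont_sum => l.
by apply: tcontM; [exact: tcontM|exact: tcont_cst].
Qed.

Lemma vderiv_cst a (x : 'rV[R]_a) : vderiv (fun=> x) (fun=> 0).
Proof. by move=> k t _; rewrite mxE; exact: is_derive_cst. Qed.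

Lemma vderivB a (x x' y y' : R -> 'rV[R]_a) : vderiv x x' -> vderiv y y' ->
  vderiv (fun t => x t - y t) (fun t => x' t - y' t).
Proof.
move=> dx dy k t tT; rewrite !mxE.
rewrite (_ : (fun s => _) = (fun s => x s ord0 k) - (fun s => y s ord0 k));
  last first.
  by apply/funext => s; rewrite !mxE.
by apply: is_deriveB; [exact: dx|exact: dy].
Qed.

Lemma is_derive_bf a b (N : 'M[R]_(a, b)) x x' y y' t :
  vderiv x x' -> vderiv y y' -> 0 < t < T ->
  is_derive t (1 : R) (fun s => bf N (x s) (y s))
    (bf N (x' t) (y t) + bf N (x t) (y' t)).
Proof.
move=> dx dy tT.
rewrite (_ : (fun s => _) = \sum_k \sum_l
    ((fun s => x s ord0 k) * (fun s => y s ord0 l)) * cst (N k l)); last first.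
  apply/funext => s; rewrite bfE fct_sumE; apply: eq_bigr => k _.
  by rewrite fct_sumE.
rewrite !bfE -big_split /=.
apply: is_derive_sum => k; rewrite -big_split /=; apply: is_derive_sum => l.
have dxk := dx k t tT; have dyl := dy l t tT.
apply: is_derive_eq.
rewrite scaler0 add0r /= /cst /GRing.scale /=; ring.
Qed.

Lemma vintE a (x : R -> 'rV[R]_a) t k :
  vint x t ord0 k = time_int t (fun s => x s ord0 k).
Proof. by rewrite mxE. Qed.

Lemma vintD a (x y : R -> 'rV[R]_a) t : 0 <= t <= T -> vcont x -> vcont y ->
  vint (fun s => x s + y s) t = vint x t + vint y t.
Proof.
move=> tT cx cy; apply/rowP => k; rewrite [RHS]mxE !vintE.
rewrite -(time_intD tT)//.
by congr time_int; apply/funext => s; rewrite mxE.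
Qed.

Lemma vintZ a c (x : R -> 'rV[R]_a) t : 0 <= t <= T -> vcont x ->
  vint (fun s => c *: x s) t = c *: vint x t.
Proof.
move=> tT cx; apply/rowP => k; rewrite [RHS]mxE !vintE.
rewrite -(time_intZ _ tT)//.
by congr time_int; apply/funext => s; rewrite mxE.
Qed.

Lemma time_int_sum n (F : 'I_n -> R -> R) t : 0 <= t <= T ->
  (forall i, tcont T (F i)) ->
  time_int t (fun s => \sum_i F i s) = \sum_i time_int t (F i).
Proof.
move=> tT; elim: n F => [F _|n IH F cF].
  rewrite big_ord0 (_ : (fun s => _) = fun=> 0).
    by rewrite time_int_cst ?mul0r//; case/andP: tT.
  by apply/funext => s; rewrite big_ord0.
rewrite big_ord_recl -IH// -(time_intD tT)//; last exact: tcont_sum.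
by congr time_int; apply/funext => s; rewrite big_ord_recl.
Qed.

Lemma vint_mulmx a b (N : 'M[R]_(a, b)) x t : 0 <= t <= T -> vcont x ->
  vint (fun s => x s *m N) t = vint x t *m N.
Proof.
move=> tT cx; apply/rowP => k; rewrite [RHS]mxE vintE.
under eq_bigr do rewrite vintE mulrC -(time_intZ _ tT)//.
rewrite -(time_int_sum tT); last by move=> i; exact: tcontZ.
by congr time_int; apply/funext => s; rewrite mxE; apply: eq_bigr => i _;
  rewrite mulrC.
Qed.

Lemma vint_FTC a (x x' : R -> 'rV[R]_a) t : 0 <= t <= T ->
  vcont x -> vcont x' -> vderiv x x' -> vint x' t = x t - x 0.
Proof.
move=> tT cx cx' dx; apply/rowP => k; rewrite vintE !mxE.
apply: (@time_int_FTC _ T t (fun s => x s ord0 k)) => // s sT; exact: dx.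
Qed.

End curves.

(** * Symmetric nonnegative forms *)

(** The discriminant of a nonnegative quadratic polynomial. *)
Lemma discr_le0 (R : realFieldType) (a b c : R) : 0 <= c ->
  (forall s, 0 <= a + 2 * s * b + s ^+ 2 * c) -> b ^+ 2 <= a * c.
Proof.
rewrite le_eqVlt => /predU1P[<-|c0] h.
  have [->|b0] := eqVneq b 0; first by rewrite expr0n mulr0.
  have := h (- (a + 1) / (2 * b)).
  rewrite (_ : _ + _ = -1); first by rewrite lerNr oppr0 ler10.
  by field.
have := h (- b / c); rewrite (_ : _ + _ = a - b ^+ 2 / c); last first.
  by field; rewrite gt_eqF.
by rewrite subr_ge0 ler_pdivrMr.
Qed.

Section forms.
Variables (R : realType) (m : nat) (M : 'M[R]_m).
Hypotheses (Ms : M^T = M) (M0 : forall x, 0 <= bf M x x).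

Lemma bf_CS x y : bf M x y ^+ 2 <= bf M x x * bf M y y.
Proof.
apply: discr_le0 => // s; have := M0 (x + s *: y).
rewrite bfDl !bfDr !bfZl !bfZr (bfC y x)//; congr (_ <= _); ring.
Qed.

Hypothesis Mp : forall x, bf M x x = 0 -> x = 0.

Lemma pd_unitmx : M \in unitmx.
Proof.
rewrite -row_free_unit -kermx_eq0; apply/eqP/eqP/rowV0P => v /sub_kermxP vM.
by apply: Mp; rewrite /bf vM mul0mx mxE.
Qed.

(** Every coordinate is the pairing with a fixed vector, hence is controlled by
    the energy norm of a definite form. *)
Lemma pd_coord_le : exists2 C : R, 0 <= C &
  forall (x : 'rV[R]_m) k, x ord0 k ^+ 2 <= C * bf M x x.
Proof.
pose g k : 'rV[R]_m := delta_mx ord0 k *m invmx M.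
exists (\sum_k bf M (g k) (g k)); first exact: sumr_ge0.
move=> x k; have <- : bf M (g k) x = x ord0 k.
  by rewrite /bf /g mulmxKV ?pd_unitmx// -rowE !mxE.
apply: le_trans (bf_CS _ _) _; rewrite ler_wpM2r// (bigD1 k)//= lerDl.
exact: sumr_ge0.
Qed.

Lemma pd_bf_le (N : 'M[R]_m) : exists2 C : R, 0 <= C &
  forall x, bf N x x <= C * bf M x x.
Proof.
have [C C0 hC] := pd_coord_le.
exists (\sum_k \sum_l C * `|N k l|).
  by apply: sumr_ge0 => k _; apply: sumr_ge0 => l _; rewrite mulr_ge0.
move=> x; rewrite bfE mulr_suml; apply: ler_sum => k _.
rewrite mulr_suml; apply: ler_sum => l _.
apply: le_trans (ler_norm _) _; rewrite normrM mulrAC ler_wpM2r//.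
rewrite ler_norml; have := hC x k; have := hC x l => h1 h2.
have := sqr_ge0 (x ord0 k + x ord0 l); have := sqr_ge0 (x ord0 k - x ord0 l).
by move=> *; apply/andP; split; nra.
Qed.

End forms.

(** * The contraction estimate *)

(** A mass form M, a nonnegative form B and a coupling form Sg lying between 0
    and 2 L M: the data of the scheme once the displacement is eliminated. *)
Section scheme.
Variables (R : realType) (T : R) (m : nat).
Hypothesis T0 : 0 < T.
Variables (M B Sg : 'M[R]_m) (b L : R).
Hypotheses (Ms : M^T = M) (M0 : forall x, 0 <= bf M x x).
Hypotheses (Bs : B^T = B) (B0 : forall x, 0 <= bf B x x).
Hypotheses (Sgs : Sg^T = Sg) (Sg0 : forall x, 0 <= bf Sg x x)
  (SgM : forall x, bf Sg x x <= 2 * L * bf M x x).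
Hypotheses (b0 : 0 < b) (L0 : 0 < L).

(** The coupling enters only through the form L M - Sg, which lies between
    - L M and L M; polarization then bounds it by the norm of M. *)
Lemma coupling_le x y :
  bf (L *: M - Sg) y x <= L / 2 * (bf M x x + bf M y y).
Proof.
have := SgM (x - y); have := Sg0 (x + y).
rewrite bfBm bfZm !bfBl !bfDl !bfBr !bfDr !(bfC y x)//.
by move=> *; lra.
Qed.

(** Test the equation with e' and integrate; B contributes a time derivative. *)
Lemma energy_estimate e e' y t :
  vcont T e -> vcont T e' -> vcont T y -> vderiv T e e' -> e 0 = 0 ->
  (forall s, 0 <= s <= T ->
    (b + L) *: (e' s *m M) + e s *m B + y s *m Sg = L *: (y s *m M)) ->
  0 <= t <= T ->
  (b + L / 2) * time_int t (fun s => bf M (e' s) (e' s))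
    + bf B (e t) (e t) / 2
  <= L / 2 * time_int t (fun s => bf M (y s) (y s)).
Proof.
move=> ce ce' cy de e0 eqn tT.
have cM := tcont_bf (N := M) ce' ce'; have cY := tcont_bf (N := M) cy cy.
have cBe := tcont_bf (N := B) ce' ce; have cB := tcont_bf (N := B) ce ce.
have -> : bf B (e t) (e t) / 2 = time_int t (fun s => bf B (e' s) (e s)).
  rewrite -[LHS]subr0.
  have -> : 0 = 2^-1 * bf B (e 0) (e 0) by rewrite e0 bf0l mulr0.
  rewrite mulrC; symmetry.
  apply: (@time_int_FTC _ T t (fun s => 2^-1 * bf B (e s) (e s))) => //.
    exact: tcontZ.
  move=> s sT; have dB := is_derive_bf B de de sT.
  rewrite (_ : bf B (e' s) (e s) =
    2^-1 *: (bf B (e' s) (e s) + bf B (e s) (e' s))); first exact: is_deriveZ.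
  by rewrite (bfC (e s))// /GRing.scale /=; field.
rewrite -!(time_intZ _ tT)// -(time_intD tT)//; last exact: tcontZ.
apply: (time_int_le tT) => //; [|exact: tcontZ|].
  by apply: tcontD => //; exact: tcontZ.
move=> s sT; have /(congr1 (fun v => bf 1%:M v (e' s))) := eqn s sT.
rewrite !bfDl !bfZl -!bf_dot (bfC (e s))// => h.
have := coupling_le (e' s) (y s); rewrite bfBm bfZm => k.
by lra.
Qed.

(** The contraction factor. *)
Definition rate : R := L / (b + L).

Lemma rate_lt1 : rate < 1.
Proof. by rewrite /rate ltr_pdivrMr ?addr_gt0// mul1r ltrDr. Qed.

Lemma rate_ge0 : 0 <= rate.
Proof. by rewrite /rate divr_ge0// ltW// addr_gt0. Qed.

Lemma energy_contraction e e' y t :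
  vcont T e -> vcont T e' -> vcont T y -> vderiv T e e' -> e 0 = 0 ->
  (forall s, 0 <= s <= T ->
    (b + L) *: (e' s *m M) + e s *m B + y s *m Sg = L *: (y s *m M)) ->
  0 <= t <= T ->
  time_int t (fun s => bf M (e' s) (e' s))
  <= rate * time_int t (fun s => bf M (y s) (y s)).
Proof.
move=> ce ce' cy de e0 eqn tT.
have := energy_estimate ce ce' cy de e0 eqn tT; have := B0 (e t).
set X := time_int _ _; set Y := time_int _ _ => h1 h2.
have X0 : 0 <= X by exact: (time_int_ge0 tT).
have Y0 : 0 <= Y by exact: (time_int_ge0 tT).
rewrite /rate mulrAC ler_pdivlMr ?addr_gt0// mulrC.
have h3 : (b + L / 2) * X <= L / 2 * Y by lra.
(* the energy estimate gives the factor L / (2 b + L), smaller than the rate *)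
have bX : 0 <= b * X by rewrite mulr_ge0// ltW.
have [XY|YX] := leP X Y; nra.
Qed.

(** A curve starting from 0 is controlled by its velocity: expand the
    nonnegative integral of |e' - e(t)/t|^2. *)
Lemma velocity_bound e e' t : vcont T e -> vcont T e' -> vderiv T e e' ->
  e 0 = 0 -> 0 <= t <= T ->
  bf M (e t) (e t) <= T * time_int T (fun s => bf M (e' s) (e' s)).
Proof.
move=> ce ce' de e0 /andP[t0 tT]; move: t0; rewrite le_eqVlt => /predU1P[<-|t0].
  rewrite e0 bf0l mulr_ge0//; first exact: ltW.
  by apply: (@time_int_ge0 _ T) => [|s _]; [rewrite lexx ltW|exact: M0].
have tT' : 0 <= t <= T by rewrite ltW.
have cM := tcont_bf (N := M) ce' ce'.
apply: le_trans (_ : t * time_int t (fun s => bf M (e' s) (e' s)) <= _);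
  last first.
  apply: ler_pM => //; [exact: ltW|exact: (time_int_ge0 tT')|].
  exact: time_int_mono.
set c := t^-1 *: e t.
have : 0 <= time_int t (fun s => bf M (e' s - c) (e' s - c))
  by exact: (time_int_ge0 tT').
rewrite (_ : (fun s => _) = fun s => bf M (e' s) (e' s) +
    (- 2 * bf M c (e' s) + bf M c c)); last first.
  by apply/funext => s; rewrite bfBl !bfBr (bfC (e' s) c)//; ring.
have cc : vcont T (fun=> c) by exact: vcont_cst.
have dc : vderiv T (fun=> c) (fun=> 0) by exact: vderiv_cst.
have cMc : tcont T (fun s => bf M c (e' s)) by exact: tcont_bf.
have cK : tcont T (fun=> bf M c c) by exact: tcont_cst.
rewrite (time_intD tT')//; last by apply: tcontD => //; exact: tcontZ.
rewrite (time_intD tT')//; last exact: tcontZ.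
rewrite (time_intZ _ tT')// time_int_cst; last exact: ltW.
have -> : time_int t (fun s => bf M c (e' s)) = bf M c (e t) - bf M c (e 0).
  apply: (@time_int_FTC _ T t (fun s => bf M c (e s))) => //;
    first exact: tcont_bf.
  move=> s sT; rewrite -[X in is_derive _ _ _ X]add0r.
  have := is_derive_bf M dc de sT.
  by rewrite /= bf0l.
rewrite e0 bf0r subr0 /c bfZl bfZl bfZr.
set I := time_int _ _; set Z := bf _ _ _ => h.
have : 0 <= t * (I + (- 2 * (t^-1 * Z) + t^-1 * (t^-1 * Z) * t))
  by rewrite mulr_ge0// ltW.
rewrite (_ : t * _ = t * I - Z); first by rewrite subr_ge0.
by field; rewrite gt_eqF.
Qed.

End scheme.

(** * Limits *)

(** A sequence of continuous functions whose increments decay geometrically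
    converges uniformly to a continuous function. With rho j = K r^j / (1 - r),
    f j - rho j increases and f j + rho j decreases in j, so the supremum of
    the former is the limit. *)
Lemma geometric_limit (R : realType) (T K r : R) (f : nat -> R -> R) :
  0 <= K -> 0 <= r < 1 -> (forall j, tcont T (f j)) ->
  (forall j t, 0 <= t <= T -> `|f j.+1 t - f j t| <= K * r ^+ j) ->
  exists2 F : R -> R, tcont T F &
    forall j t, 0 <= t <= T -> `|f j t - F t| <= K / (1 - r) * r ^+ j.
Proof.
move=> K0 /andP[r0 r1] cf df.
have r1' : 0 < 1 - r by rewrite subr_gt0.
pose rho j := K / (1 - r) * r ^+ j.
have rho0 j : 0 <= rho j by rewrite /rho !mulr_ge0 ?exprn_ge0 ?invr_ge0
  ?(ltW r1').
have rhoS j : rho j = rho j.+1 + K * r ^+ j.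
  by rewrite /rho exprS; field; rewrite gt_eqF.
pose lo t := [set y | exists j, y = f j t - rho j].
have mono t : 0 <= t <= T -> forall j k,
    f j t - rho j <= f (j + k)%N t - rho (j + k)%N /\
    f (j + k)%N t + rho (j + k)%N <= f j t + rho j.
  move=> tT j; elim=> [|k [IH1 IH2]]; first by rewrite addn0.
  rewrite addnS; have := df (j + k)%N t tT; rewrite ler_norml => /andP[h1 h2].
  have := rhoS (j + k)%N => h3; split; lra.
have ub t : 0 <= t <= T -> forall j k, f j t - rho j <= f k t + rho k.
  move=> tT j k; have [h1 _] := mono t tT j k; have [_ h2] := mono t tT k j.
  rewrite addnC in h2; have := rho0 (j + k)%N; lra.
set F := fun t => sup (lo t).
have Fle j t : 0 <= t <= T -> `|f j t - F t| <= rho j.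
  move=> tT; rewrite ler_norml; apply/andP; split.
    rewrite lerBrDr addrC -lerBrDr opprK; apply: ge_sup; last first.
      by move=> _ [k ->]; exact: ub.
    by exists (f 0%N t - rho 0%N), 0%N.
  rewrite lerBlDr -lerBlDl; apply: ub_le_sup; last by exists j.
  by exists (f 0%N t + rho 0%N) => _ [k ->]; exact: ub.
exists F; last exact: Fle.
have rho_small eps : 0 < eps -> exists j, rho j <= eps.
  move=> e0; have : rho @ \oo --> 0.
    by apply: (@cvg_geometric _ (K / (1 - r))); rewrite ger0_norm.
  move=> /cvgrPdist_le/(_ _ e0)[j _ /(_ j (leqnn j))].
  by rewrite /= sub0r normrN ger0_norm// => hj; exists j.
move=> x; have [xT|xT] := pselect ([set` `[0, T]] (x : R)); last first.
  move=> V /nbhs_singleton VF.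
  suff: nbhs_subspace x (F @^-1` V) by [].
  by rewrite -nbhs_subspace_out// => y ->.
have xT' : 0 <= x <= T by have := xT; rewrite /= in_itv.
apply/cvgrPdist_le => eps e0.
have e3 : 0 < eps / 3 by rewrite divr_gt0.
have [j hj] := rho_small _ e3.
near=> y.
have yT : 0 <= y <= T.
  suff : [set` `[0, T]] (y : R) by rewrite /= in_itv.
  near: y; suff: nbhs_subspace x [set` `[0, T]] by [].
  by rewrite -nbhs_subspace_in//; exact: withinT.
have h1 := Fle j x xT'; have h2 := Fle j y yT.
have h3 : `|f j x - f j y| <= eps / 3.
  by near: y; apply: (cvgrPdist_le _ _).1 e3; exact: (cf j x).
move: h1 h2 h3; rewrite !ler_norml /from_subspace => /andP[? ?] /andP[? ?]
  /andP[? ?].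
by apply/andP; split; lra.
Unshelve. all: by end_near. Qed.

Lemma cvg_dist_le (R : realType) (u e : nat -> R) (l : R) :
  (forall i, `|u i - l| <= e i) -> e @ \oo --> 0 -> u @ \oo --> l.
Proof.
move=> ue e0; apply/subr_cvg0/norm_cvg0P.
by apply: (squeeze_cvgr _ (cvg_cst 0) e0); apply: nearW => i;
  rewrite normr_ge0/=.
Qed.

Section vector_limits.
Variable R : realType.

(** Convergence of a sequence of vectors, coordinate by coordinate. *)
Definition vlim a (x : nat -> 'rV[R]_a) (X : 'rV[R]_a) :=
  forall k, x i ord0 k @[i --> \oo] --> X ord0 k.

Lemma vlim_cst a (X : 'rV[R]_a) : vlim (fun=> X) X.
Proof. by move=> k; exact: cvg_cst. Qed.

Lemma vlimD a (x y : nat -> 'rV[R]_a) X Y :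
  vlim x X -> vlim y Y -> vlim (fun i => x i + y i) (X + Y).
Proof.
move=> hx hy k; rewrite mxE; under eq_fun do rewrite mxE.
by apply: cvgD; [exact: hx|exact: hy].
Qed.

Lemma vlimB a (x y : nat -> 'rV[R]_a) X Y :
  vlim x X -> vlim y Y -> vlim (fun i => x i - y i) (X - Y).
Proof.
move=> hx hy k; rewrite !mxE; under eq_fun do rewrite !mxE.
by apply: cvgB; [exact: hx|exact: hy].
Qed.

Lemma vlimZ a c (x : nat -> 'rV[R]_a) X :
  vlim x X -> vlim (fun i => c *: x i) (c *: X).
Proof.
move=> hx k; rewrite mxE; under eq_fun do rewrite mxE.
by apply: cvgM; [exact: cvg_cst|exact: hx].
Qed.

Lemma vlim_mulmx a b (N : 'M[R]_(a, b)) x X :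
  vlim x X -> vlim (fun i => x i *m N) (X *m N).
Proof.
move=> hx k; rewrite mxE; under eq_fun do rewrite mxE.
by apply: cvg_sum_ord => l; apply: cvgM; [exact: hx|exact: cvg_cst].
Qed.

Lemma vlimS a (x : nat -> 'rV[R]_a) X : vlim x X -> vlim (fun i => x i.+1) X.
Proof.
by move=> hx k; have := hx k;
  rewrite -[X in X -> _](cvg_shiftS (fun i => x i ord0 k)).
Qed.

Lemma vlim_unique a (x : nat -> 'rV[R]_a) X Y : vlim x X -> vlim x Y -> X = Y.
Proof.
by move=> hX hY; apply/rowP => k;
  exact: (cvg_unique (@Rhausdorff R) (hX k) (hY k)).
Qed.

End vector_limits.

(** * The iteration for the pressure alone *)

Section iteration.
Variables (R : realType) (T : R) (m : nat).
Hypothesis T0 : 0 < T.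
Variables (M B Sg : 'M[R]_m) (b L : R).
Hypotheses (Ms : M^T = M) (M0 : forall x, 0 <= bf M x x)
  (Mp : forall x, bf M x x = 0 -> x = 0).
Hypotheses (Bs : B^T = B) (B0 : forall x, 0 <= bf B x x).
Hypotheses (Sgs : Sg^T = Sg) (Sg0 : forall x, 0 <= bf Sg x x)
  (SgM : forall x, bf Sg x x <= 2 * L * bf M x x).
Hypotheses (b0 : 0 < b) (L0 : 0 < L).
Variables (p p' : nat -> R -> 'rV[R]_m) (G : R -> 'rV[R]_m) (p0 : 'rV[R]_m).
Hypotheses (cp : forall i, vcont T (p i)) (cp' : forall i, vcont T (p' i))
  (dp : forall i, vderiv T (p i) (p' i)) (cG : vcont T G).
Hypothesis init : forall i, p i 0 = p0.
Hypothesis eqn : forall i t, 0 <= t <= T ->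
  (b + L) *: (p' i.+1 t *m M) + p i.+1 t *m B + p' i t *m Sg
  = L *: (p' i t *m M) + G t.

Let q := rate b L.

(** The squared norm in L2(0, T), with respect to M, of a velocity. *)
Definition energy (v : R -> 'rV[R]_m) := time_int T (fun s => bf M (v s) (v s)).

Lemma energy_ge0 v : 0 <= energy v.
Proof. by apply: (@time_int_ge0 _ T) => [|s _];
  [rewrite lexx ltW|exact: M0]. Qed.

Lemma increment_contraction i :
  energy (fun s => p' i.+2 s - p' i.+1 s)
  <= q * energy (fun s => p' i.+1 s - p' i s).
Proof.
apply: (energy_contraction Ms M0 Bs B0 Sgs Sg0 SgM b0 L0
  (e := fun s => p i.+2 s - p i.+1 s)).
- exact: vcontB.
- exact: vcontB.
- exact: vcontB.
- exact: vderivB.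
- by rewrite !init subrr.
- move=> s sT; rewrite !mulmxBl !scalerBr.
  have := eqn i.+1 sT; have := eqn i sT.
  move: (p' i.+2 s *m M) (p i.+2 s *m B) (p' i.+1 s *m Sg) (p' i.+1 s *m M).
  move: (p i.+1 s *m B) (p' i s *m Sg) (p' i s *m M) => x1 x2 x3 x4 x5 x6 x7.
  move=> /rowP h1 /rowP h2; apply/rowP => k; have := h1 k; have := h2 k.
  by rewrite !mxE => ? ?; lra.
- by rewrite ltW//= lexx.
Qed.

(** A solution of the coupled problem with the displacement eliminated. *)
Definition solves (P h : R -> 'rV[R]_m) :=
  [/\ vcont T P, vcont T h, vderiv T P h, P 0 = p0 &
  forall t, 0 <= t <= T -> b *: (h t *m M) + P t *m B + h t *m Sg = G t].

Lemma error_contraction P h i : solves P h ->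
  energy (fun s => p' i.+1 s - h s) <= q * energy (fun s => p' i s - h s).
Proof.
move=> [cP ch dP P0 hP].
apply: (energy_contraction Ms M0 Bs B0 Sgs Sg0 SgM b0 L0
  (e := fun s => p i.+1 s - P s)).
- exact: vcontB.
- exact: vcontB.
- exact: vcontB.
- exact: vderivB.
- by rewrite init P0 subrr.
- move=> s sT; rewrite !mulmxBl !scalerBr.
  have := eqn i sT; have := hP s sT.
  move: (p' i.+1 s *m M) (p i.+1 s *m B) (p' i s *m Sg) (p' i s *m M).
  move: (h s *m M) (P s *m B) (h s *m Sg) => x1 x2 x3 x4 x5 x6 x7.
  move=> /rowP h1 /rowP h2; apply/rowP => k; have := h1 k; have := h2 k.
  by rewrite !mxE => ? ?; lra.
- by rewrite ltW//= lexx.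
Qed.

Lemma error_decay P h i : solves P h ->
  energy (fun s => p' i s - h s) <= q ^+ i * energy (fun s => p' 0%N s - h s).
Proof.
move=> hPh; elim: i => [|i IH]; first by rewrite expr0 mul1r.
apply: le_trans (error_contraction _ hPh) _.
by rewrite exprS -mulrA ler_wpM2l// rate_ge0.
Qed.

Lemma increment_decay i :
  energy (fun s => p' i.+1 s - p' i s)
  <= q ^+ i * energy (fun s => p' 1%N s - p' 0%N s).
Proof.
elim: i => [|i IH]; first by rewrite expr0 mul1r.
apply: le_trans (increment_contraction i) _.
by rewrite exprS -mulrA ler_wpM2l// rate_ge0.
Qed.

(** The increments of the velocities decay geometrically, hence so do those of
    the pressures, uniformly in time. *)
Lemma pressures_converge : exists2 P : R -> 'rV[R]_m, vcont T P &
  exists K, forall i t k, 0 <= t <= T ->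
    `|p i t ord0 k - P t ord0 k| <= K * Num.sqrt q ^+ i.
Proof.
have [C C0 hC] := pd_coord_le Ms M0 Mp.
have q0 : 0 <= q by exact: rate_ge0.
set E := energy (fun s => p' 1%N s - p' 0%N s).
have E0 : 0 <= E by exact: energy_ge0.
set K := Num.sqrt (C * (T * E)).
have r1 : 0 <= Num.sqrt q < 1.
  by rewrite sqrtr_ge0/= -sqrtr1 ltr_sqrt// rate_lt1.
have lim k : exists2 F, tcont T F & forall j t, 0 <= t <= T ->
    `|p j t ord0 k - F t| <= K / (1 - Num.sqrt q) * Num.sqrt q ^+ j.
  apply: (@geometric_limit _ T K (Num.sqrt q) (fun j t => p j t ord0 k)) => //.
  - exact: sqrtr_ge0.
  - by move=> j; exact: cp.
  move=> j t tT.
  have -> : p j.+1 t ord0 k - p j t ord0 k = (p j.+1 t - p j t) ord0 k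
    by rewrite !mxE.
  rewrite -ler_sqr ?nnegrE ?mulr_ge0 ?exprn_ge0 ?sqrtr_ge0//.
  rewrite real_normK ?num_real//.
  rewrite exprMn -exprM mulnC exprM (sqr_sqrtr q0) sqr_sqrtr ?mulr_ge0//
    ?(ltW T0)//.
  apply: le_trans (hC _ _) _; rewrite -mulrA ler_wpM2l// -mulrA [E * _]mulrC.
  have vb := @velocity_bound _ T m T0 M Ms M0 (fun s => p j.+1 s - p j s)
    (fun s => p' j.+1 s - p' j s) t.
  apply: le_trans (vb _ _ _ _ tT) _.
  - by apply: vcontB; exact: cp.
  - by apply: vcontB; exact: cp'.
  - by apply: vderivB; exact: dp.
  - by rewrite !init subrr.
  by rewrite ler_wpM2l ?(ltW T0)//; exact: increment_decay.
have [F hF] := boolp.choice (fun k => let: ex_intro2 f cf hf := lim k in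
  ex_intro (fun f => tcont T f /\ _) f (conj cf hf)).
exists (fun t => \row_k F k t).
  move=> k; under [X in tcont _ X]eq_fun do rewrite mxE.
  by have [] := hF k.
exists (K / (1 - Num.sqrt q)) => i t k tT; rewrite mxE.
by have [_] := hF k; apply.
Qed.

Lemma mass_unitmx : b *: M + Sg \in unitmx.
Proof.
have hN x : bf (b *: M + Sg) x x = b * bf M x x + bf Sg x x
  by rewrite bfDm bfZm.
apply: pd_unitmx => x; rewrite hN => h; apply: Mp; apply/eqP.
have := Sg0 x; have := M0 x; rewrite le_eqVlt => /predU1P[<-//|Mx Sx].
by have := mulr_gt0 b0 Mx; lra.
Qed.

(** The limit P of the pressures is a solution. The velocities need not be
    known to converge pointwise, so the passage to the limit is done in the
    equation integrated in time, which shows that P is an antiderivative of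
    the velocity h prescribed by the equation. *)
Lemma solution_exists : exists P h, solves P h.
Proof.
have [P cP [K hK]] := pressures_converge.
pose N := b *: M + Sg; have uN : N \in unitmx by exact: mass_unitmx.
pose h t := (G t - P t *m B) *m invmx N.
have cB : vcont T (fun t => P t *m B) by exact: vcont_mulmx.
have ch : vcont T h by apply: vcont_mulmx; exact: vcontB.
(* agrees with P on [0, T], and is visibly an antiderivative of h *)
pose Q t := p0 + vint h t.
have hN t : h t *m N = G t - P t *m B by rewrite /h mulmxKV.
have cvK : (fun i => K * Num.sqrt q ^+ i) @ \oo --> 0.
  rewrite -(mulr0 K); apply: cvgM; [exact: cvg_cst|apply: cvg_expr].
  by rewrite ger0_norm ?sqrtr_ge0// -sqrtr1 ltr_sqrt// rate_lt1.
have cvp t : 0 <= t <= T -> vlim (fun i => p i t) (P t).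
  by move=> tT k; apply: (cvg_dist_le (e := fun i => K * Num.sqrt q ^+ i))
    => // i; exact: hK.
have cvI t : 0 <= t <= T -> vlim (fun i => vint (p i) t) (vint P t).
  move=> tT k; apply: (cvg_dist_le (e := fun i => K * Num.sqrt q ^+ i * t))
    => [i|].
    have cd : tcont T (fun s => p i s ord0 k - P s ord0 k) by apply: tcontB;
      [exact: cp|exact: cP].
    rewrite !vintE -(time_intB tT); [|exact: cp|exact: cP].
    have t0 : 0 <= t by case/andP: tT.
    have bnd s : 0 <= s <= T -> - (K * Num.sqrt q ^+ i)
        <= p i s ord0 k - P s ord0 k <= K * Num.sqrt q ^+ i.
      by move=> sT; rewrite -ler_norml; exact: hK.
    have cK c : tcont T (fun=> c) by exact: tcont_cst.
    rewrite ler_norml -mulNr -!(@time_int_cst _ t)//; apply/andP; split.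
      by apply: (time_int_le tT (cK _) cd) => s /bnd/andP[].
    by apply: (time_int_le tT cd (cK _)) => s /bnd/andP[].
  by rewrite -(mul0r t); apply: cvgM => //; exact: cvg_cst.
have PQ t : 0 <= t <= T -> P t = Q t.
  move=> tT; have h1 i :
      (b + L) *: ((p i.+1 t - p0) *m M) + vint (p i.+1) t *m B
      + (p i t - p0) *m Sg = L *: ((p i t - p0) *m M) + vint G t.
    have cM j : vcont T (fun s => p' j s *m M) by apply: vcont_mulmx;
      exact: cp'.
    have cS j : vcont T (fun s => p' j s *m Sg) by apply: vcont_mulmx;
      exact: cp'.
    have cBi j : vcont T (fun s => p j s *m B) by apply: vcont_mulmx; exact: cp.
    have FT j : p j t - p0 = vint (p' j) t.
      by rewrite (vint_FTC tT (@cp j) (@cp' j) (@dp j)) init.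
    have cZ j : vcont T (fun s => (b + L) *: (p' j s *m M)) by apply: vcontZ;
      exact: cM.
    have cL j : vcont T (fun s => L *: (p' j s *m M)) by apply: vcontZ;
      exact: cM.
    have cZB j : vcont T (fun s => (b + L) *: (p' j s *m M) + p j s *m B).
      by apply: vcontD; [exact: cZ|exact: cBi].
    have ZM c j : c *: (vint (p' j) t *m M)
      = vint (fun s => c *: (p' j s *m M)) t.
      by rewrite -(vint_mulmx _ tT (@cp' j)) -(vintZ _ tT (@cM j)).
    rewrite !FT !ZM -(vint_mulmx _ tT (@cp i.+1)) -(vint_mulmx _ tT (@cp' i)).
    rewrite -(vintD tT (@cZ i.+1) (@cBi i.+1)) -(vintD tT (@cZB i.+1) (@cS i)).
    rewrite -(vintD tT (@cL i) cG).
    rewrite /vint; apply/rowP => k; rewrite !mxE; apply: eq_Rintegral => s.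
    rewrite inE /= in_itv/= => /andP[s0 st].
    by rewrite eqn// s0 (le_trans st)//; case/andP: tT.
  have h2 : (b + L) *: ((P t - p0) *m M) + vint P t *m B + (P t - p0) *m Sg
      = L *: ((P t - p0) *m M) + vint G t.
    have cvd : vlim (fun i => p i t - p0) (P t - p0).
      by apply: vlimB; [exact: cvp|exact: vlim_cst].
    apply: (@vlim_unique _ _ (fun i => (b + L) *: ((p i.+1 t - p0) *m M)
      + vint (p i.+1) t *m B + (p i t - p0) *m Sg)).
      apply: vlimD; last exact: vlim_mulmx.
      apply: vlimD; first by apply/vlimZ/vlim_mulmx; exact: (vlimS cvd).
      by apply: vlim_mulmx; exact: (vlimS (cvI t tT)).
    under eq_fun do rewrite h1.
    by apply: vlimD; [apply/vlimZ/vlim_mulmx|exact: vlim_cst].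
  have h3 : (P t - p0) *m N = vint G t - vint P t *m B.
    rewrite /N mulmxDr -scalemxAr.
    move: h2; move: ((P t - p0) *m M) ((P t - p0) *m Sg) (vint P t *m B)
      (vint G t).
    move=> x1 x2 x3 x4 /rowP hk; apply/rowP => k; have :=
      hk k; rewrite !mxE; lra.
  have h4 : vint h t *m N = vint G t - vint P t *m B.
    have cPB : vcont T (fun s => - 1 *: (P s *m B)) by exact: vcontZ.
    rewrite -(vint_mulmx _ tT ch) -(vint_mulmx _ tT cP).
    rewrite -[- vint _ _]scaleN1r -(vintZ _ tT cB) -(vintD tT cG cPB).
    by congr vint; apply/funext => s; rewrite hN scaleN1r.
  have : (P t - p0) *m N *m invmx N = vint h t *m N *m invmx N by rewrite h3 h4.
  by rewrite !mulmxK// /Q => <-; rewrite addrC subrK.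
exists Q, h; split => //.
- apply: vcontD; first exact: vcont_cst.
  by move=> k; under [X in tcont _ X]eq_fun do rewrite vintE;
    exact: tcont_time_int.
- move=> k t tT.
  rewrite (_ : (fun s => _) = cst (p0 ord0 k) +
      (fun s => time_int s (fun r => h r ord0 k))); last first.
    by apply/funext => s; rewrite mxE vintE.
  rewrite -[h t ord0 k]add0r; apply: is_deriveD.
  exact: (is_derive_time_int T0 (ch k) tT).
- rewrite -PQ ?lexx ?ltW//.
  by apply: vlim_unique (cvp 0 _) _; rewrite ?lexx ?ltW// => k;
    under eq_fun do rewrite init; exact: cvg_cst.
- move=> t tT; rewrite -PQ// scalemxAr addrAC -mulmxDr hN subrK //.
Qed.

End iteration.

(** * Square integrable functions *)

(** An open set is the union of the rational boxes that it contains. *)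
Lemma open_measurable_rV (R : realType) n (U : set 'rV[R]_n) :
  open U -> measurable U.
Proof.
move=> oU.
pose box (z : 'rV[rat]_n * nat) : set 'rV[R]_n :=
  [set x | forall i, `|ratr (z.1 ord0 i) - x ord0 i| < z.2.+1%:R^-1].
pose F z := if `[< box z `<=` U >] then box z else set0.
have -> : U = \bigcup_z F z.
  apply/seteqP; split => [x Ux|x [z _]]; last first.
    by rewrite /F; case: asboolP => // h; exact: h.
  have /nbhs_ballP[e /= e0 xe] : nbhs x U by exact: open_nbhs_nbhs.
  have e2 : 0 < e / 2 by rewrite divr_gt0.
  have [k _ /(_ k (leqnn k)) /= ke] := near_infty_natSinv_lt (PosNum e2).
  have k0 : 0 < k.+1%:R^-1 :> R by rewrite invr_gt0.
  have /boolp.choice[r hr] (i : 'I_n) : exists r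
    : rat, `|ratr r - x ord0 i| < k.+1%:R^-1.
    have [|r] := @rat_in_itvoo R (x ord0 i - k.+1%:R^-1)
      (x ord0 i + k.+1%:R^-1).
      by rewrite ltrD2l gtrN.
    by rewrite in_itv/= => h; exists r; rewrite ltr_distl.
  exists (\row_i r i, k) => //; rewrite /F; case: asboolP => [_ i|[]];
    first by rewrite /= mxE.
  move=> y hy; apply: xe; split => // i j; rewrite ord1.
  have := hy j; rewrite /= mxE => h1; have h2 := hr j.
  rewrite /ball /= (le_lt_trans (ler_distD (ratr (r j)) _ _))//.
  by rewrite (distrC (x ord0 j)) [ltRHS]splitr ltrD// (lt_trans _ ke).
apply: countable_bigcupT_measurable => [|z]; first exact: countableP.
rewrite /F; case: asboolP => // _.
rewrite [X in measurable X](_ : _ = \bigcap_(i in [set: 'I_n]) (rV_coord i @^-1`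
    [set y | `|ratr (z.1 ord0 i) - y| < z.2.+1%:R^-1])).
  apply: fin_bigcap_measurable => // i _.
  rewrite -[X in measurable X]setTI; apply: measurable_rV_coord => //.
  rewrite (_ : [set y | _] = [set` `]ratr (z.1 ord0 i) - z.2.+1%:R^-1,
      ratr (z.1 ord0 i) + z.2.+1%:R^-1[]); first exact: measurable_itv.
  by apply/seteqP; split => y /=; rewrite in_itv/= ltr_distlC.
by apply/seteqP; split => x /= h i; [move=> _|]; exact: (h i).
Qed.

Section square_integrable.
Context {R : realType} {d : nat}.
Variable Omega : set 'rV[R]_d.
Hypothesis mO : measurable Omega.
Implicit Types f g : 'rV[R]_d -> R.
Let mu := @lebesgue_rV R d.

Lemma integrable_mul f g : L2 Omega f -> L2 Omega g ->
  mu.-integrable Omega (EFin \o (fun x => f x * g x)).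
Proof.
move=> [mf If] [mg Ig].
apply: (@le_integrable _ _ _ _ _ mO _
  (fun x => (f x ^+ 2)%:E + (g x ^+ 2)%:E)%E).
- by apply/measurable_EFinP; exact: measurable_funM.
- move=> x _ /=; rewrite lee_fin [leRHS]ger0_norm ?addr_ge0 ?sqr_ge0//
  ler_norml.
  have := sqr_ge0 (f x + g x); have := sqr_ge0 (f x - g x).
  by move=> *; apply/andP; split; nra.
- exact: integrableD.
Qed.

Lemma L2D f g : L2 Omega f -> L2 Omega g -> L2 Omega (fun x => f x + g x).
Proof.
move=> Lf Lg; have Ifg := integrable_mul Lf Lg.
move: Lf Lg => [mf If] [mg Ig]; split; first exact: measurable_funD.
rewrite (_ : _ \o _ = (fun x => (f x ^+ 2)%:E +
    ((g x ^+ 2)%:E + 2%:E * (f x * g x)%:E))%E).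
  by apply: integrableD => //; apply: integrableD => //; exact: integrableZl.
by apply/funext => x; rewrite /= -EFinM -!EFinD; congr EFin; ring.
Qed.

Lemma L2Z c f : L2 Omega f -> L2 Omega (fun x => c * f x).
Proof.
move=> [mf If]; split; first exact: measurable_funM.
rewrite (_ : _ \o _ = (fun x => (c ^+ 2)%:E * (f x ^+ 2)%:E)%E).
  exact: integrableZl.
by apply/funext => x; rewrite /= -EFinM exprMn.
Qed.

Lemma L2_0 : L2 Omega (fun=> 0).
Proof.
split; first exact: measurable_cst.
rewrite (_ : _ \o _ = cst 0%E); first exact: integrable0.
by apply/funext => x; rewrite /= expr0n.
Qed.

Lemma L2_sum n (f : 'I_n -> 'rV[R]_d -> R) :
  (forall k, L2 Omega (f k)) -> L2 Omega (fun x => \sum_k f k x).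
Proof.
elim: n f => [|n IH] f Lf; first by under eq_fun do rewrite big_ord0;
  exact: L2_0.
under eq_fun do rewrite big_ord_recl.
by apply: L2D => //; exact: IH.
Qed.

Lemma L2_bounded_mul (w : 'rV[R]_d -> R) f (M : R) : measurable_fun Omega w ->
  (forall x, Omega x -> `|w x| <= M) -> L2 Omega f ->
    L2 Omega (fun x => w x * f x).
Proof.
move=> mw wM [mf If]; split; first exact: measurable_funM.
apply: (@le_integrable _ _ _ _ _ mO _ (fun x => (M ^+ 2)%:E * (f x ^+ 2)%:E)%E).
- by apply/measurable_EFinP/measurable_funX; exact: measurable_funM.
- move=> x Ox /=; rewrite lee_fin exprMn !normrM ler_wpM2r//.
  have wM' : `|w x| <= `|M| by rewrite (le_trans (wM x Ox))// ler_norm.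
  exact: ler_pM.
- exact: integrableZl.
Qed.

Lemma ipC f g : ip Omega f g = ip Omega g f.
Proof. by rewrite /ip; under eq_Rintegral do rewrite mulrC. Qed.

Lemma ipDl f f' g : L2 Omega f -> L2 Omega f' -> L2 Omega g ->
  ip Omega (fun x => f x + f' x) g = ip Omega f g + ip Omega f' g.
Proof.
move=> Lf Lf' Lg; rewrite /ip; under eq_Rintegral do rewrite mulrDl.
by rewrite RintegralD//; exact: integrable_mul.
Qed.

Lemma ipZl c f g : L2 Omega f -> L2 Omega g ->
  ip Omega (fun x => c * f x) g = c * ip Omega f g.
Proof.
move=> Lf Lg; rewrite /ip; under eq_Rintegral do rewrite -mulrA.
by rewrite RintegralZl//; exact: integrable_mul.
Qed.

Lemma ip_suml n (f : 'I_n -> 'rV[R]_d -> R) g :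
  (forall k, L2 Omega (f k)) -> L2 Omega g ->
  ip Omega (fun x => \sum_k f k x) g = \sum_k ip Omega (f k) g.
Proof.
elim: n f => [|n IH] f Lf Lg.
  rewrite big_ord0 /ip; under eq_Rintegral do rewrite big_ord0 mul0r.
  by rewrite Rintegral_cst// mul0r.
rewrite big_ord_recl -IH//; under [X in ip _ X _]eq_fun do rewrite big_ord_recl.
by rewrite ipDl//; exact: L2_sum.
Qed.

Lemma ip_comb a b (f : 'I_a -> 'rV[R]_d -> R) (g : 'I_b -> 'rV[R]_d -> R)
    (c : 'I_a -> R) (e : 'I_b -> R) :
  (forall k, L2 Omega (f k)) -> (forall l, L2 Omega (g l)) ->
  ip Omega (fun x => \sum_k c k * f k x) (fun x => \sum_l e l * g l x)
  = bf (\matrix_(k, l) ip Omega (f k) (g l)) (\row_k c k) (\row_l e l).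
Proof.
move=> Lf Lg; rewrite bfE ip_suml; last 2 first.
- by move=> k; exact: L2Z.
- by apply: L2_sum => l; exact: L2Z.
apply: eq_bigr => k _; rewrite ipC ip_suml; last 2 first.
- by move=> l; exact: L2Z.
- exact: L2Z.
apply: eq_bigr => l _; rewrite !mxE ipZl//; last exact: L2Z.
by rewrite ipC ipZl// mulrCA mulrA.
Qed.

Lemma ip_ge0 f : 0 <= ip Omega f f.
Proof. by apply: Rintegral_ge0 => x _; rewrite -expr2 sqr_ge0. Qed.

Lemma ip_CS f g : L2 Omega f -> L2 Omega g ->
  ip Omega f g ^+ 2 <= ip Omega f f * ip Omega g g.
Proof.
move=> Lf Lg; apply: discr_le0; first exact: ip_ge0.
move=> s; have Ls : L2 Omega (fun x => s * g x) by exact: L2Z.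
have := ip_ge0 (fun x => f x + s * g x).
rewrite ipDl//; last exact: L2D.
rewrite ![ip _ _ (fun x => _ + _)]ipC !ipDl// !ipZl//
  !(ipC _ (fun x => s * _)) !ipZl//.
by rewrite (ipC g f) => h; apply: le_trans h _; rewrite le_eqVlt; apply/orP;
  left; apply/eqP; ring.
Qed.

Lemma ip_eq0 f : L2 Omega f -> ip Omega f f = 0 ->
  {ae mu, forall x, Omega x -> f x = 0}.
Proof.
move=> Lf f0; have If := integrable_mul Lf Lf.
have : (\int[mu]_(x in Omega) `|(f x * f x)%:E| = 0)%E.
  rewrite (eq_integral (fun x => (f x * f x)%:E)); last first.
    by move=> x _; rewrite /= ger0_norm// -expr2 sqr_ge0.
  by rewrite -(fineK (integrable_fin_num mO If)); congr EFin.
move/(ae_eq_integral_abs mu mO _).1 => /(_ (measurable_int mu If)).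
apply: filterS => x h Ox; have /eqP := h Ox.
by rewrite eqe mulf_eq0 orbb => /eqP.
Qed.

End square_integrable.

(** * The discrete forms *)

Lemma bf_sum (R : realType) a b I (r : seq I) (N : I -> 'M[R]_(a, b)) x y :
  bf (\sum_(i <- r) N i) x y = \sum_(i <- r) bf (N i) x y.
Proof.
elim/big_rec2: _ => [|i s Q _ <-]; last by rewrite bfDm.
by rewrite /bf mulmx0 mul0mx mxE.
Qed.

(** Expand the sum of the squares of the deviations from the mean. *)
Lemma sqr_sum_le (R : realFieldType) n (a : 'I_n -> R) : (0 < n)%N ->
  (\sum_i a i) ^+ 2 <= n%:R * \sum_i a i ^+ 2.
Proof.
move=> n0; have n0' : 0 < n%:R :> R by rewrite ltr0n.
set s := \sum_i a i.
have : 0 <= \sum_i (a i - s / n%:R) ^+ 2 by apply: sumr_ge0 => i _;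
  exact: sqr_ge0.
rewrite (eq_bigr (fun i => a i ^+ 2
  + (- 2 * (s / n%:R) * a i + (s / n%:R) ^+ 2))); last first.
  by move=> i _; ring.
rewrite !big_split /= -mulr_sumr -/s sumr_const card_ord.
set Q := \sum_i _ => h.
have : 0 <= n%:R * (Q + (- 2 * (s / n%:R) * s + (s / n%:R) ^+ 2 * n%:R))
  by rewrite mulr_natr mulr_ge0// ltW.
rewrite (_ : _ * _ = n%:R * Q - s ^+ 2); first by rewrite subr_ge0.
by field; rewrite gt_eqF.
Qed.

(** Square integrability of a function and of its gradient; unlike H1, no
    relation between the two is required. *)
Definition L2grad (R : realType) d (Omega : set 'rV[R]_d) (w : wfun) : Prop :=
  L2 Omega (val w) /\ forall j, L2 Omega (grad w j).

Section discrete_forms.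
Context {R : realType} {d : nat}.
Variables (Omega : set 'rV[R]_d) (P : biot_params R d).
Hypotheses (mO : measurable Omega) (hP : admissible Omega P).
Variables (n m : nat) (phi : 'I_n -> @vfun R d) (psi : 'I_m -> @wfun R d).
Hypotheses (Hphi : forall k l, L2grad Omega (phi k l))
  (Hpsi : forall k, L2grad Omega (psi k)).
Let mu := @lebesgue_rV R d.

(** Matrices of the L2 inner product, of the coupling form (div v, q) and of
    the forms a and b in the given bases. *)
Definition mass_mx : 'M[R]_m :=
  \matrix_(k, l) ip Omega (val (psi k)) (val (psi l)).
Definition div_mx : 'M[R]_(n, m) :=
  \matrix_(k, l) ip Omega (div (phi k)) (val (psi l)).
Definition stiff_mx : 'M[R]_n := \matrix_(k, l) aform Omega P (phi k) (phi l).
Definition permeability_mx : 'M[R]_m :=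
  \matrix_(k, l) bform Omega P (psi k) (psi l).

Lemma L2_div v : (forall l, L2grad Omega (v l)) -> L2 Omega (div v).
Proof. by move=> hv; apply: L2_sum => // l; exact: (hv l).2. Qed.

Lemma L2_strain v i j : (forall l, L2grad Omega (v l)) ->
  L2 Omega (strain v i j).
Proof.
move=> hv; rewrite (_ : strain v i j
  = fun x => 2^-1 * (grad (v i) j x + grad (v j) i x)).
  by apply: L2Z => //; apply: L2D => //; exact: (hv _).2.
by apply/funext => x; rewrite /strain mulrC.
Qed.

Lemma Rintegral_sum_ord N (f : 'I_N -> 'rV[R]_d -> R) :
  (forall i, mu.-integrable Omega (EFin \o f i)) ->
  mu.-integrable Omega (EFin \o (fun x => \sum_i f i x)) /\
  \int[mu]_(x in Omega) (\sum_i f i x) = \sum_i \int[mu]_(x in Omega) f i x.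
Proof.
elim: N f => [|N IH] f If.
  split; last by rewrite big_ord0; under eq_Rintegral do rewrite big_ord0;
    rewrite Rintegral_cst// mul0r.
  by under [X in _ \o X]eq_fun do rewrite big_ord0; exact: integrable0.
have [I1 I2] := IH (fun i => f (lift ord0 i)) (fun i => If _).
rewrite big_ord_recl -I2; split.
  under [X in _ \o X]eq_fun do rewrite big_ord_recl.
  exact: (integrableD mO (If ord0) I1).
by under eq_Rintegral do rewrite big_ord_recl; rewrite RintegralD.
Qed.

Lemma Rintegral_ip_sum N N' (f g : 'I_N -> 'I_N' -> 'rV[R]_d -> R) :
  (forall i j, L2 Omega (f i j)) -> (forall i j, L2 Omega (g i j)) ->
  mu.-integrable Omega (EFin \o (fun x => \sum_i \sum_j f i j x * g i j x)) /\
  \int[mu]_(x in Omega) (\sum_i \sum_j f i j x * g i j x)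
  = \sum_i \sum_j ip Omega (f i j) (g i j).
Proof.
move=> Lf Lg; have I1 i := Rintegral_sum_ord
  (fun j => integrable_mul mO (Lf i j) (Lg i j)).
have [I2 I3] := Rintegral_sum_ord (fun i => (I1 i).1).
by split => //; rewrite I3; apply: eq_bigr => i _; exact: (I1 i).2.
Qed.

Lemma aformE u v : (forall l, L2grad Omega (u l)) ->
  (forall l, L2grad Omega (v l)) ->
  aform Omega P u v =
  2 * shear P * (\sum_i \sum_j ip Omega (strain u i j) (strain v i j))
  + lame P * ip Omega (div u) (div v).
Proof.
move=> hu hv; rewrite /aform (Rintegral_ip_sum _ _).2// => i j;
  exact: L2_strain.
Qed.

(** The (i, j) contribution to the flux of p. *)
Let flux (p : @wfun R d) i j x := perm P x i j / visc P * grad p j x.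

Lemma L2_flux p i j : L2grad Omega p -> L2 Omega (flux p i j).
Proof.
move=> hp; have [[_ _ _ _ v0] [mK [N hN] _ _]] := hP.
apply: (@L2_bounded_mul _ _ _ mO _ _ (N / visc P)).
- by apply: measurable_funM => //; exact: mK.
- move=> x Ox; rewrite normrM normfV (gtr0_norm v0) ler_pM2r ?invr_gt0//.
  exact: hN.
- exact: hp.2.
Qed.

Lemma bformE p q : L2grad Omega p -> L2grad Omega q ->
  bform Omega P p q = \sum_i \sum_j ip Omega (flux p i j) (grad q i).
Proof.
move=> hp hq; rewrite /bform
  (@Rintegral_ip_sum _ _ (fun i j => flux p i j) (fun i j => grad q i) _ _).2//.
- by move=> i j; exact: L2_flux.
- by move=> i j; exact: hq.2.
Qed.

Lemma div_vcomb c : div (vcomb phi c) = fun x => \sum_k c k * div (phi k) x.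
Proof.
apply/funext => x; rewrite /div /= exchange_big /=; apply: eq_bigr => k _.
by rewrite mulr_sumr.
Qed.

Lemma strain_vcomb c i j :
  strain (vcomb phi c) i j = fun x => \sum_k c k * strain (phi k) i j x.
Proof.
apply/funext => x; rewrite /strain /= -big_split mulr_suml;
  apply: eq_bigr => k _ /=.
by rewrite -mulrDr mulrA.
Qed.

Lemma L2grad_wcomb c : L2grad Omega (wcomb psi c).
Proof.
by split=> [|j]; apply: L2_sum => // k; apply: L2Z => //;
  [exact: (Hpsi k).1|exact: (Hpsi k).2].
Qed.

Lemma L2grad_vcomb c l : L2grad Omega (vcomb phi c l).
Proof.
by split=> [|j]; apply: L2_sum => // k; apply: L2Z => //;
  [exact: (Hphi k l).1|exact: (Hphi k l).2].
Qed.

Lemma ip_wcomb c e : ip Omega (val (wcomb psi c)) (val (wcomb psi e))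
  = bf mass_mx (\row_k c k) (\row_k e k).
Proof. by apply: ip_comb => // k; exact: (Hpsi k).1. Qed.

Lemma ip_div_wcomb c e : ip Omega (div (vcomb phi c)) (val (wcomb psi e))
  = bf div_mx (\row_k c k) (\row_k e k).
Proof. by rewrite div_vcomb; apply: ip_comb => // k;
  [exact: L2_div|exact: (Hpsi k).1]. Qed.

Let strain_mx i j : 'M[R]_n :=
  \matrix_(k, l) ip Omega (strain (phi k) i j) (strain (phi l) i j).
Let divdiv_mx : 'M[R]_n := \matrix_(k, l) ip Omega (div (phi k)) (div (phi l)).

Lemma stiff_mxE : stiff_mx =
  (2 * shear P) *: (\sum_i \sum_j strain_mx i j) + lame P *: divdiv_mx.
Proof.
apply/matrixP => k l; rewrite !mxE summxE aformE//; congr (_ * _ + _).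
by apply: eq_bigr => i _; rewrite summxE; apply: eq_bigr => j _; rewrite mxE.
Qed.

Lemma aform_vcomb c e : aform Omega P (vcomb phi c) (vcomb phi e)
  = bf stiff_mx (\row_k c k) (\row_k e k).
Proof.
rewrite stiff_mxE bfDm !bfZm bf_sum /aform; congr (_ * _ + _ * _).
  rewrite (Rintegral_ip_sum _ _).2.
  - apply: eq_bigr => i _; rewrite bf_sum; apply: eq_bigr => j _.
    by rewrite !strain_vcomb; apply: ip_comb => // k; exact: L2_strain.
  - by move=> i j; apply: L2_strain => l; exact: L2grad_vcomb.
  - by move=> i j; apply: L2_strain => l; exact: L2grad_vcomb.
by rewrite !div_vcomb; apply: ip_comb => // k; exact: L2_div.
Qed.

Let flux_mx i j : 'M[R]_m :=
  \matrix_(k, l) ip Omega (flux (psi k) i j) (grad (psi l) i).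

Lemma bform_wcomb c e : bform Omega P (wcomb psi c) (wcomb psi e)
  = bf permeability_mx (\row_k c k) (\row_k e k).
Proof.
have -> : permeability_mx = \sum_i \sum_j flux_mx i j.
  apply/matrixP => k l; rewrite !mxE summxE bformE//.
  by apply: eq_bigr => i _; rewrite summxE; apply: eq_bigr => j _; rewrite mxE.
have fluxE i j : flux (wcomb psi c) i j
  = fun x => \sum_k c k * flux (psi k) i j x.
  by apply/funext => x; rewrite /flux /= mulr_sumr; apply: eq_bigr => k _;
    rewrite mulrCA.
rewrite bf_sum /bform.
rewrite (@Rintegral_ip_sum _ _ (fun i j => flux (wcomb psi c) i j)
  (fun i j => grad (wcomb psi e) i) _ _).2.
- apply: eq_bigr => i _; rewrite bf_sum; apply: eq_bigr => j _.
  by rewrite fluxE; apply: ip_comb => // k; [exact: L2_flux|exact: (Hpsi k).2].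
- by move=> i j; rewrite fluxE; apply: L2_sum => // k; apply: L2Z => //;
  exact: L2_flux.
- by move=> i j; apply: L2_sum => // k; apply: L2Z => //; exact: (Hpsi k).2.
Qed.

Lemma rowK a (x : 'rV[R]_a) : \row_k x ord0 k = x.
Proof. by apply/rowP => k; rewrite mxE. Qed.

Lemma mass_mx_sym : mass_mx^T = mass_mx.
Proof. by apply/matrixP => k l; rewrite !mxE ipC. Qed.

Lemma mass_mx_ge0 x : 0 <= bf mass_mx x x.
Proof. by rewrite -(rowK x) -ip_wcomb; exact: ip_ge0. Qed.

Lemma stiff_mx_sym : stiff_mx^T = stiff_mx.
Proof.
apply/matrixP => k l; rewrite !mxE !aformE// ipC; congr (_ * _ + _).
by apply: eq_bigr => i _; apply: eq_bigr => j _; rewrite ipC.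
Qed.

Lemma permeability_mx_sym : permeability_mx^T = permeability_mx.
Proof.
have [_ [_ _ Ks _]] := hP.
apply/matrixP => k l; rewrite !mxE; apply: eq_Rintegral => x; rewrite inE => Ox.
rewrite exchange_big; apply: eq_bigr => i _; apply: eq_bigr => j _ /=.
by rewrite -[in LHS](Ks x Ox) mxE mulrAC.
Qed.

Lemma permeability_mx_ge0 x : 0 <= bf permeability_mx x x.
Proof.
have [[_ _ _ _ v0] [_ _ _ Kp]] := hP.
rewrite -(rowK x) -bform_wcomb; move: (wcomb _ _) => p.
apply: Rintegral_ge0 => y Oy.
pose xi : 'cV[R]_d := \col_i grad p i y.
have -> : \sum_i \sum_j perm P y i j / visc P * grad p j y * grad p i y
    = (xi^T *m perm P y *m xi) ord0 ord0 / visc P.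
  rewrite mxE mulr_suml; under [RHS]eq_bigr do rewrite !mxE mulr_suml mulr_suml.
  rewrite exchange_big; apply: eq_bigr => i _; apply: eq_bigr => j _ /=.
  by rewrite !mxE; field; rewrite gt_eqF.
rewrite divr_ge0 ?(ltW v0)//.
have [->|xi0] := eqVneq xi 0; first by rewrite mulmx0 mxE.
by rewrite ltW// Kp.
Qed.

(** The trace of the strain is the divergence, so (div v)^2 is at most d times
    the square of the strain. *)
Lemma div_le_aform (hd : (0 < d)%N) v : (forall l, L2grad Omega (v l)) ->
  (2 * shear P / d%:R + lame P) * ip Omega (div v) (div v) <= aform Omega P v v.
Proof.
move=> hv; have [[G0 l0 _ _ _] _] := hP.
have d0 : 0 < d%:R :> R by rewrite ltr0n.
rewrite mulrDl /aform lerD2r -mulrA ler_pM2l ?mulr_gt0//.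
rewrite ler_pdivrMl// /ip -RintegralZl//; last first.
  by apply: (Rintegral_ip_sum _ _).1 => i j; exact: L2_strain.
apply: le_Rintegral => //.
- by apply: integrable_mul => //; exact: L2_div.
- have := @Rintegral_ip_sum _ _ (fun i j => strain v i j)
  (fun i j => strain v i j).
  case; try by move=> i j; exact: L2_strain.
  move=> I _; rewrite (_ : _ \o _
    = (fun x => d%:R%:E * (\sum_i \sum_j strain v i j x * strain v i j
    x)%:E)%E).
    exact: integrableZl.
  by apply/funext => x.
move=> x _; rewrite -expr2; apply: le_trans (sqr_sum_le _ hd) _.
rewrite ler_pM2l//; apply: ler_sum => l _.
rewrite (bigD1 l)//= /strain -expr2 (_ : _ / 2 = grad (v l) l x); last by field.
by rewrite lerDl; apply: sumr_ge0 => j _; rewrite -expr2 sqr_ge0.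
Qed.

End discrete_forms.

(** * Elimination of the displacement *)

Section elimination.
Variables (R : realType) (n m : nat) (A : 'M[R]_n) (C : 'M[R]_(n, m))
  (M : 'M[R]_m).
Variable K : R.
Hypotheses (K0 : 0 < K) (As : A^T = A) (A0 : forall v, 0 <= bf A v v)
  (M0 : forall x, 0 <= bf M x x)
  (coupling : forall v x, K * bf C v x ^+ 2 <= bf A v v * bf M x x).

Lemma ker_coupling (v : 'rV[R]_n) : v *m A = 0 -> v *m C = 0.
Proof.
move=> vA; apply: bf_inj => x; rewrite -bf_dot bf0l.
have := coupling v x; rewrite [bf A v v]bf_dot vA bf0l mul0r pmulr_rle0// => h.
by apply/eqP; rewrite -sqrf_eq0 eq_le h sqr_ge0.
Qed.

(** A may be singular, but its kernel is contained in that of C, so C^T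
    factors through A as S A; S C is then the Schur complement term. *)
Lemma schur_factor : exists S : 'M[R]_(m, n), S *m A = C^T.
Proof.
exists (C^T *m pinvmx A); apply: mulmxKpV; rewrite submxE; apply/eqP.
apply: trmx_inj; rewrite trmx_mul trmxK trmx0; apply/row_matrixP => i.
rewrite row0 row_mul; apply: ker_coupling.
have cA : (cokermx A)^T *m A = 0 by rewrite -{2}As -trmx_mul mulmx_coker trmx0.
by rewrite -row_mul cA row0.
Qed.

Variable S : 'M[R]_(m, n).
Hypothesis SA : S *m A = C^T.

Lemma SAE : A *m S^T = C.
Proof. by rewrite -[LHS]trmxK trmx_mul trmxK As SA trmxK. Qed.

Lemma schur_sym : (S *m C)^T = S *m C.
Proof. by rewrite -SAE !trmx_mul trmxK As mulmxA. Qed.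

Lemma schurE x : bf (S *m C) x x = bf A (x *m S) (x *m S).
Proof. by rewrite /bf trmx_mul -SAE !mulmxA. Qed.

Lemma schur_ge0 x : 0 <= bf (S *m C) x x.
Proof. by rewrite schurE. Qed.

Lemma schur_le x : K * bf (S *m C) x x <= bf M x x.
Proof.
have := coupling (x *m S) x; rewrite -schurE.
have -> : bf C (x *m S) x = bf (S *m C) x x by rewrite /bf !mulmxA.
have := schur_ge0 x; rewrite le_eqVlt => /predU1P[<-|t0];
  first by rewrite mulr0.
by rewrite expr2 mulrCA ler_pM2l.
Qed.

(** The displacement paired with C depends on the pressure only. *)
Lemma eliminate a (v : 'rV[R]_n) (x : 'rV[R]_m) : v *m A = a *: (x *m C^T) ->
  v *m C = a *: (x *m (S *m C)).
Proof.
move=> vA; have : (v - a *: (x *m S)) *m C = 0.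
  by apply: ker_coupling; rewrite mulmxBl vA -scalemxAl -mulmxA SA subrr.
by rewrite mulmxBl -scalemxAl mulmxA => /eqP; rewrite subr_eq0 => /eqP.
Qed.

(** Test the equation with v and apply the coupling inequality. *)
Lemma displacement_le a (v : 'rV[R]_n) (x : 'rV[R]_m) :
  v *m A = a *: (x *m C^T) ->
  bf A v v <= a ^+ 2 / K * bf M x x.
Proof.
move=> vA.
have e : bf A v v = a * bf C v x.
  by rewrite bf_dot vA bfZl -bf_dot bf_tr.
have := coupling v x; have := A0 v; rewrite le_eqVlt => /predU1P[<- _|v0 h].
  by rewrite mulr_ge0 ?divr_ge0 ?sqr_ge0 ?(ltW K0)//.
rewrite mulrAC ler_pdivlMr// -(ler_pM2l v0).
have : a ^+ 2 * (K * bf C v x ^+ 2) <= a ^+ 2 * (bf A v v * bf M x x).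
  by rewrite ler_wpM2l// sqr_ge0.
rewrite (_ : a ^+ 2 * (K * _) = bf A v v * (bf A v v * K)); last by rewrite e;
  ring.
by rewrite [in X in _ <= X -> _]mulrCA.
Qed.

End elimination.

(** * Coefficient curves *)

Section curves_more.
Variables (R : realType) (T : R).
Hypothesis T0 : 0 < T.

Lemma vcont_eq a (x y : R -> 'rV[R]_a) : vcont T x -> vcont T y ->
  (forall t, 0 < t < T -> x t = y t) -> forall t, 0 <= t <= T -> x t = y t.
Proof.
move=> cx cy xy t tT; apply/rowP => k.
by apply: (tcont_eq T0 (cx k) (cy k)) => // s sT; rewrite xy.
Qed.

Lemma vderiv_mulmx a b (N : 'M[R]_(a, b)) (x x' : R -> 'rV[R]_a) :
  vderiv T x x' -> vderiv T (fun t => x t *m N) (fun t => x' t *m N).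
Proof.
move=> dx k t tT.
have E (y : 'rV[R]_a) : (y *m N) ord0 k = bf N y (delta_mx ord0 k).
  by rewrite /bf trmx_delta -colE [RHS]mxE.
rewrite E; under [X in is_derive _ _ X _]eq_fun do rewrite E.
have dc : vderiv T (fun=> delta_mx ord0 k : 'rV[R]_b) (fun=> 0)
  by exact: vderiv_cst.
by have := is_derive_bf N dx dc tT; rewrite /= bf0r addr0.
Qed.

Lemma vderiv_const a (x x' : R -> 'rV[R]_a) c : vderiv T x x' ->
  (forall t, 0 < t < T -> x t = c) -> forall t, 0 < t < T -> x' t = 0.
Proof.
move=> dx xc t tT; apply/rowP => k; have dxk := dx k t tT.
have d0 : is_derive t (1 : R) (fun s => x s ord0 k) 0.
  apply: (near_eq_is_derive _ (is_derive_cst (c ord0 k) t 1)).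
  near=> s; rewrite xc//.
  suff : s \in `]0, T[ by rewrite in_itv.
  by near: s; apply: near_in_itvoo; rewrite in_itv.
by rewrite mxE -(@derive_val _ _ _ _ _ _ _ dxk) (@derive_val _ _ _ _ _ _ _ d0).
Unshelve. all: by end_near. Qed.

Variable N : nat.
(** The vectors of coefficients of a curve and of its time derivative. *)
Definition curve (c : c1curve T N) (t : R) : 'rV[R]_N := \row_k coef c k t.
Definition dcurve (c : c1curve T N) (t : R) : 'rV[R]_N := \row_k dcoef c k t.

Lemma vcont_curve c : vcont T (curve c).
Proof.
move=> k; under [X in tcont _ X]eq_fun do rewrite mxE.
by case: c => f g cf cg df; exact: cf.
Qed.

Lemma vcont_dcurve c : vcont T (dcurve c).
Proof.
move=> k; under [X in tcont _ X]eq_fun do rewrite mxE.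
by case: c => f g cf cg df; exact: cg.
Qed.

Lemma vderiv_curve c : vderiv T (curve c) (dcurve c).
Proof.
move=> k t tT; rewrite mxE; under [X in is_derive _ _ X _]eq_fun do rewrite mxE.
by case: c => f g cf cg df; exact: df.
Qed.

(** A vector curve with continuous derivative, as a family of coefficients. *)
Lemma curve_of (x x' : R -> 'rV[R]_N) : vcont T x -> vcont T x' ->
  vderiv T x x' ->
  exists2 c : c1curve T N, curve c = x & dcurve c = x'.
Proof.
move=> cx cx' dx.
exists (@C1curve R T N (fun k t => x t ord0 k) (fun k t => x' t ord0 k)
  (fun k => cx k) (fun k => cx' k) (fun k t => dx k t)).
  by apply/funext => t; apply/rowP => k; rewrite mxE.
by apply/funext => t; apply/rowP => k; rewrite mxE.
Qed.

End curves_more.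

(** * Norms and coupling on the discrete spaces *)

Section discrete_norms.
Context {R : realType} {d : nat}.
Variables (Omega : set 'rV[R]_d) (P : biot_params R d).
Hypotheses (mO : measurable Omega) (hP : admissible Omega P) (hd : (0 < d)%N).

Lemma wsub_wcomb m (psi : 'I_m -> @wfun R d) c e :
  wsub (wcomb psi c) (wcomb psi e) = wcomb psi (fun k => c k - e k).
Proof.
rewrite /wsub /wcomb /=; congr Wfun.
  by apply/funext => x; rewrite -sumrB; apply: eq_bigr => k _; rewrite mulrBl.
apply/funext => j; apply/funext => x; rewrite -sumrB.
by apply: eq_bigr => k _; rewrite mulrBl.
Qed.

Lemma vsub_vcomb n (phi : 'I_n -> @vfun R d) c e :
  vsub (vcomb phi c) (vcomb phi e) = vcomb phi (fun k => c k - e k).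
Proof. by apply/funext => l; exact: wsub_wcomb. Qed.

Lemma H1sq_wcomb m (psi : 'I_m -> @wfun R d) :
  (forall k, L2grad Omega (psi k)) ->
  exists N : 'M[R]_m, forall c,
    H1sq Omega (wcomb psi c) = bf N (\row_k c k) (\row_k c k).
Proof.
move=> Hpsi; exists (mass_mx Omega psi +
  \sum_j \matrix_(k, l) ip Omega (grad (psi k) j) (grad (psi l) j)) => c.
rewrite /H1sq /L2sq bfDm ip_wcomb// bf_sum; congr (_ + _).
by apply: eq_bigr => j _; apply: ip_comb => // k; exact: (Hpsi k).2.
Qed.

Lemma H1sqv_vcomb n (phi : 'I_n -> @vfun R d) :
  (forall k l, L2grad Omega (phi k l)) ->
  exists N : 'M[R]_n, forall c,
    H1sqv Omega (vcomb phi c) = bf N (\row_k c k) (\row_k c k).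
Proof.
move=> Hphi.
have /boolp.choice[N hN] l := H1sq_wcomb (fun k => Hphi k l).
by exists (\sum_l N l) => c; rewrite bf_sum; apply: eq_bigr => l _; exact: hN.
Qed.

Variables (n m : nat) (phi : 'I_n -> @vfun R d) (psi : 'I_m -> @wfun R d).
Hypotheses (Hphi : forall k l, L2grad Omega (phi k l))
  (Hpsi : forall k, L2grad Omega (psi k)).

(** The constant in the bound of (div v, div v) by a(v, v). *)
Definition bulk : R := 2 * shear P / d%:R + lame P.

Lemma bulk_gt0 : 0 < bulk.
Proof.
have [[G0 l0 _ _ _] _] := hP.
by rewrite /bulk ltr_wpDr// divr_gt0 ?mulr_gt0 ?ltr0n.
Qed.

Lemma stiff_mx_ge0 v : 0 <= bf (stiff_mx Omega P phi) v v.
Proof.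
rewrite -(rowK v) -(aform_vcomb P mO Hphi).
apply: le_trans (div_le_aform mO hP hd (L2grad_vcomb mO Hphi _)).
by rewrite mulr_ge0 ?ip_ge0// (ltW bulk_gt0).
Qed.

(** Cauchy-Schwarz for (div v, q), and the bound of div v by a(v, v). *)
Lemma coupling_bound v x : bulk * bf (div_mx Omega phi psi) v x ^+ 2
  <= bf (stiff_mx Omega P phi) v v * bf (mass_mx Omega psi) x x.
Proof.
rewrite -(rowK v) -(rowK x) -(aform_vcomb P mO Hphi) -(ip_wcomb mO Hpsi).
rewrite -(ip_div_wcomb mO Hphi Hpsi).
have Hv := L2grad_vcomb mO Hphi (fun k => v ord0 k).
have Hx := L2grad_wcomb mO Hpsi (fun k => x ord0 k).
apply: le_trans (_ : bulk * (ip Omega _ _ * ip Omega _ _) <= _).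
  rewrite ler_wpM2l ?(ltW bulk_gt0)//.
  by apply: (ip_CS mO) Hx.1; exact: L2_div.
by rewrite mulrA ler_wpM2r ?ip_ge0//; exact: (div_le_aform mO hP hd).
Qed.

End discrete_norms.

(** * The fixed-stress split method *)

Section splitting.
Context {R : realType} {d : nat}.
Variables (Omega Gt Gc : set 'rV[R]_d) (P : biot_params R d) (T : R).
Hypotheses (hd : (0 < d)%N) (mO : measurable Omega) (hP : admissible Omega P)
  (T0 : 0 < T).
Variables (n m : nat) (phi : 'I_n -> @vfun R d) (psi : 'I_m -> @wfun R d).
Hypotheses (hphi : basis_in_V Omega Gc phi) (hpsi : basis_in_Q Omega Gt psi).
Variables (f : R -> 'rV[R]_d -> R) (p0 : 'I_m -> R) (L : R).
Hypothesis hL : alpha P ^+ 2 / (2 * (2 * shear P / d%:R + lame P)) <= L.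
Variables (u : nat -> c1curve T n) (p : nat -> c1curve T m).
Hypothesis hup : fixed_stress Omega P phi psi f L p0 u p.

Local Notation M := (mass_mx Omega psi).
Local Notation A := (stiff_mx Omega P phi).
Local Notation B := (permeability_mx Omega P psi).
Local Notation C := (div_mx Omega phi psi).
Local Notation a := (alpha P).
Local Notation b := ((beta P)^-1).

Lemma phi_L2grad k l : L2grad Omega (phi k l).
Proof. by have [[Lv Lg _] _] := hphi.1 k l; split. Qed.

Lemma psi_L2grad k : L2grad Omega (psi k).
Proof. by have [[Lv Lg _] _] := hpsi.1 k; split. Qed.

Lemma alpha_gt0 : 0 < a. Proof. by case: hP => [[]]. Qed.

Lemma b_gt0 : 0 < b.
Proof. by case: hP => [[_ _ _ h _] _]; rewrite invr_gt0. Qed.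

Lemma L_gt0 : 0 < L.
Proof.
apply: lt_le_trans hL; rewrite divr_gt0 ?exprn_gt0 ?alpha_gt0//.
by rewrite mulr_gt0//; exact: (bulk_gt0 hP hd).
Qed.

Lemma mass_mx_definite x : bf M x x = 0 -> x = 0.
Proof.
rewrite -{1 2}(rowK x) -(ip_wcomb mO psi_L2grad) => h.
apply/rowP => k; rewrite mxE; apply: hpsi.2 k.
by apply: (ip_eq0 mO) h; exact: (L2grad_wcomb mO psi_L2grad _).1.
Qed.

Let Ms := mass_mx_sym Omega psi.
Let Mge0 := mass_mx_ge0 mO psi_L2grad.
Let As := stiff_mx_sym P mO phi_L2grad.
Let Age0 := stiff_mx_ge0 mO hP hd phi_L2grad.
Let Bs := permeability_mx_sym hP psi.
Let Bge0 := permeability_mx_ge0 mO hP psi_L2grad.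
Let coup := coupling_bound mO hP hd phi_L2grad psi_L2grad.
Let K0 := bulk_gt0 hP hd.
Let ip_div := ip_div_wcomb mO phi_L2grad psi_L2grad.
Let af_row := aform_vcomb P mO phi_L2grad.
Let bf_row := bform_wcomb mO hP psi_L2grad.
Let ip_row := ip_wcomb mO psi_L2grad.

Variable S : 'M[R]_(m, n).
Hypothesis SA : S *m A = C^T.

(** The rate of change of the pressure enters the flow equation through this
    form, the displacement being eliminated. *)
Definition coupling_mx : 'M[R]_m := a ^+ 2 *: (S *m C).

Lemma coupling_mx_sym : coupling_mx^T = coupling_mx.
Proof. by rewrite /coupling_mx linearZ /= (schur_sym As SA). Qed.

Lemma coupling_mx_ge0 x : 0 <= bf coupling_mx x x.
Proof. by rewrite bfZm mulr_ge0 ?sqr_ge0//; exact: (schur_ge0 As Age0 SA). Qed.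

(** This is where the lower bound on L is used. *)
Lemma coupling_mx_le x : bf coupling_mx x x <= 2 * L * bf M x x.
Proof.
rewrite bfZm; have h := schur_le As Age0 Mge0 coup SA x.
have := Mge0 x; set y := bf M x x in h *; set z := bf _ x x in h * => y0.
have h1 : a ^+ 2 * (bulk P * z) <= a ^+ 2 * y by rewrite ler_wpM2l// sqr_ge0.
have h2 : a ^+ 2 <= L * (2 * bulk P) by rewrite -ler_pdivrMr ?mulr_gt0.
have h3 : a ^+ 2 * y <= L * (2 * bulk P) * y by rewrite ler_wpM2r.
rewrite -(ler_pM2l K0); lra.
Qed.

(** The load functional is represented by a vector, read off from the mechanics
    equation of the first iterate. *)
Lemma load_row : exists l : 'rV[R]_n, forall c,
  body_load Omega P (vcomb phi c) = bf 1%:M l (\row_k c k).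
Proof.
exists (curve (u 1%N) T *m A - a *: (curve (p 1%N) T *m C^T)) => c.
have TT : 0 < T <= T by rewrite T0 lexx.
have [_ /(_ T TT)[_ /(_ (vcomb phi c))]] := hup 0%N.
move=> /(_ (ex_intro2 _ _ c I erefl)).
rewrite af_row ipC ip_div.
rewrite bfBl bfZl -!bf_dot [bf C^T _ _]bf_tr => ->.
by rewrite addrAC subrr add0r.
Qed.

Variable l : 'rV[R]_n.
Hypothesis hl : forall c, body_load Omega P (vcomb phi c)
  = bf 1%:M l (\row_k c k).

(** uc and pc satisfy the mechanics equation. *)
Definition mechanics (uc : c1curve T n) (pc : c1curve T m) :=
  forall t, 0 < t <= T ->
  forall v, Vh phi v -> aform Omega P (vat phi uc t) v
    = a * ip Omega (val (wat psi pc t)) (div v) + body_load Omega P v.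

Lemma mechanics_row uc pc : mechanics uc pc -> forall t, 0 <= t <= T ->
  curve uc t *m A = a *: (curve pc t *m C^T) + l.
Proof.
move=> h; apply: (vcont_eq T0).
- by apply: vcont_mulmx; exact: vcont_curve.
- apply: vcontD; last exact: vcont_cst.
  by apply/vcontZ/vcont_mulmx; exact: vcont_curve.
move=> t /andP[t0 tT]; apply: bf_inj => v.
have tT' : 0 < t <= T by rewrite t0 ltW.
have := h t tT' (vcomb phi (fun k => v ord0 k)) (ex_intro2 _ _ _ I erefl).
rewrite af_row ipC ip_div hl rowK.
by rewrite bfDl bfZl -!bf_dot [bf C^T _ _]bf_tr.
Qed.

(** The time derivative of the mechanics equation. *)
Lemma mechanics_rate_row uc pc : mechanics uc pc -> forall t, 0 <= t <= T ->
  dcurve uc t *m A = a *: (dcurve pc t *m C^T).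
Proof.
move=> h t tT; rewrite scalemxAr; move: t tT.
have duA : vderiv T (fun t => curve uc t *m A) (fun t => dcurve uc t *m A).
  by apply: vderiv_mulmx; exact: vderiv_curve.
have dpC : vderiv T (fun t => curve pc t *m (a *: C^T))
  (fun t => dcurve pc t *m (a *: C^T)).
  by apply: vderiv_mulmx; exact: vderiv_curve.
apply: (vcont_eq T0).
- by apply: vcont_mulmx; exact: vcont_dcurve.
- by apply: vcont_mulmx; exact: vcont_dcurve.
move=> r rT; apply/eqP; rewrite -subr_eq0; apply/eqP.
apply: (@vderiv_const _ T _ _ _ l (vderivB duA dpC)) rT => q /andP[q0 qT].
by rewrite (mechanics_row h) ?(ltW q0) ?ltW// -scalemxAr addrAC subrr add0r.
Qed.

Lemma mechanics_rate uc pc : mechanics uc pc -> forall t, 0 <= t <= T ->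
  a *: (dcurve uc t *m C) = dcurve pc t *m coupling_mx.
Proof.
move=> h t tT; have /(eliminate K0 coup SA) -> := mechanics_rate_row h tT.
by rewrite scalerA -expr2 scalemxAr.
Qed.

(** The right-hand side of the flow equation. It is read off from the equation
    satisfied by the first iterate, which shows that it is continuous in time
    although nothing is assumed about the dependence of f on t. *)
Definition source t : 'rV[R]_m :=
  (b + L) *: (dcurve (p 1%N) t *m M) + curve (p 1%N) t *m B
  + a *: (dcurve (u 0%N) t *m C) - L *: (dcurve (p 0%N) t *m M).

Let flow i t : 'rV[R]_m :=
  (b + L) *: (dcurve (p i.+1) t *m M) + curve (p i.+1) t *m B
  + a *: (dcurve (u i) t *m C) - L *: (dcurve (p i) t *m M).

Lemma flow_pairing i t c : 0 < t <= T -> bf 1%:M (flow i t) (\row_k c k)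
  = ip Omega (f t) (val (wcomb psi c)) + gravity_flux Omega P (wcomb psi c).
Proof.
move=> tT; have [_ /(_ t tT)[/(_ (wcomb psi c) (ex_intro2 _ _ c I erefl))
  + _]] := hup i.
rewrite bf_row !ip_row ip_div.
rewrite bfBl !bfDl !bfZl -!bf_dot /curve /dcurve => ->.
by ring.
Qed.

Lemma vcont_flow i : vcont T (flow i).
Proof.
apply: vcontB; last by apply/vcontZ/vcont_mulmx; exact: vcont_dcurve.
apply: vcontD; last by apply/vcontZ/vcont_mulmx; exact: vcont_dcurve.
apply: vcontD; first by apply/vcontZ/vcont_mulmx; exact: vcont_dcurve.
by apply: vcont_mulmx; exact: vcont_curve.
Qed.

Lemma source_pairing t c : 0 < t <= T -> bf 1%:M (source t) (\row_k c k)
  = ip Omega (f t) (val (wcomb psi c)) + gravity_flux Omega P (wcomb psi c).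
Proof. exact: (@flow_pairing 0). Qed.

Lemma flow_row i t : 0 <= t <= T -> flow i t = source t.
Proof.
apply: (vcont_eq T0 (@vcont_flow i) (@vcont_flow 0)) => s /andP[s0 sT].
apply: bf_inj => e; rewrite -(rowK e).
have sT' : 0 < s <= T by rewrite s0 ltW.
by rewrite !flow_pairing.
Qed.

(** The rate of the i-th displacement, as seen by the flow equation, is the
    one that the mechanics equation assigns to the rate of the pressure. *)
Definition rate_coupled i := forall t, 0 <= t <= T ->
  a *: (dcurve (u i) t *m C) = dcurve (p i) t *m coupling_mx.

Lemma iterate_mechanics i : mechanics (u i.+1) (p i.+1).
Proof. by move=> t tT v Vv; have [_ /(_ t tT)[_]] := hup i; apply. Qed.

Lemma iterate_coupled i : rate_coupled i.+1.
Proof. exact: mechanics_rate (@iterate_mechanics i). Qed.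

Lemma guess_coupled : consistent_guess Omega P phi psi (u 0%N) (p 0%N) ->
  rate_coupled 0.
Proof.
move=> h t tT.
have : dcurve (u 0%N) t *m A = a *: (dcurve (p 0%N) t *m C^T).
  move: t tT; apply: (vcont_eq T0).
  - by apply: vcont_mulmx; exact: vcont_dcurve.
  - by apply/vcontZ/vcont_mulmx; exact: vcont_dcurve.
  move=> t /andP[t0 tT]; apply: bf_inj => v.
  have tT' : 0 < t <= T by rewrite t0 ltW.
  have := h t tT' (vcomb phi (fun k => v ord0 k)) (ex_intro2 _ _ _ I erefl).
  rewrite af_row ipC ip_div rowK.
  by rewrite bfZl -!bf_dot [bf C^T _ _]bf_tr.
by move=> /(eliminate K0 coup SA) ->; rewrite scalerA -expr2 scalemxAr.
Qed.

(** The fixed-stress step with the displacement eliminated. *)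
Lemma reduced_step i t : rate_coupled i -> 0 <= t <= T ->
  (b + L) *: (dcurve (p i.+1) t *m M) + curve (p i.+1) t *m B
  + dcurve (p i) t *m coupling_mx
  = L *: (dcurve (p i) t *m M) + source t.
Proof.
by move=> h tT; rewrite -h// -(flow_row i tT) /flow [RHS]addrC subrK.
Qed.

Lemma init_row i : curve (p i.+1) 0 = \row_k p0 k.
Proof. by apply/rowP => k; rewrite !mxE; have [] := hup i. Qed.

Lemma increment_contracts i t : rate_coupled i -> 0 <= t <= T ->
  time_int t (fun s => bf M (dcurve (p i.+2) s - dcurve (p i.+1) s)
                            (dcurve (p i.+2) s - dcurve (p i.+1) s))
  <= L / (b + L) * time_int t (fun s =>
       bf M (dcurve (p i.+1) s - dcurve (p i) s)
            (dcurve (p i.+1) s - dcurve (p i) s)).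
Proof.
move=> h.
apply: (@energy_contraction _ T m M B coupling_mx b L Ms Mge0 Bs Bge0
  coupling_mx_sym coupling_mx_ge0 coupling_mx_le
  b_gt0 L_gt0 (fun s => curve (p i.+2) s - curve (p i.+1) s)
  (fun s => dcurve (p i.+2) s - dcurve (p i.+1) s)
  (fun s => dcurve (p i.+1) s - dcurve (p i) s)).
- by apply: vcontB; exact: vcont_curve.
- by apply: vcontB; exact: vcont_dcurve.
- by apply: vcontB; exact: vcont_dcurve.
- by apply: vderivB; exact: vderiv_curve.
- by rewrite !init_row subrr.
move=> s sT; rewrite !mulmxBl !scalerBr.
have := reduced_step (@iterate_coupled i) sT; have := reduced_step h sT.
move: (dcurve (p i.+2) s *m M) (curve (p i.+2) s *m B)
  (dcurve (p i.+1) s *m coupling_mx).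
move: (dcurve (p i.+1) s *m M) (curve (p i.+1) s *m B)
  (dcurve (p i) s *m coupling_mx).
move: (dcurve (p i) s *m M) => x1 x2 x3 x4 x5 x6 x7.
move=> /rowP h1 /rowP h2; apply/rowP => k; have := h1 k; have := h2 k.
by rewrite !mxE => ? ?; lra.
Qed.

Let solves := solves T M B coupling_mx b source (\row_k p0 k).

Lemma biot_mechanics (us : c1curve T n) (ps : c1curve T m) :
  biot_solution Omega P phi psi f us ps -> mechanics us ps.
Proof.
move=> h t tT v Vv; have [/(_ v Vv) <- _] := h t tT.
by rewrite addrC subrK.
Qed.

Lemma biot_solves (us : c1curve T n) (ps : c1curve T m) :
  biot_solution Omega P phi psi f us ps ->
  (forall k, coef ps k 0 = p0 k) -> solves (curve ps) (dcurve ps).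
Proof.
move=> h i0; split.
- exact: vcont_curve.
- exact: vcont_dcurve.
- exact: vderiv_curve.
- by apply/rowP => k; rewrite !mxE.
move=> t tT; rewrite -(mechanics_rate (biot_mechanics h) tT); move: t tT.
apply: (vcont_eq T0).
- apply: vcontD; last by apply/vcontZ/vcont_mulmx; exact: vcont_dcurve.
  apply: vcontD; first by apply/vcontZ/vcont_mulmx; exact: vcont_dcurve.
  by apply: vcont_mulmx; exact: vcont_curve.
- exact: (@vcont_flow 0).
move=> t /andP[t0 tT]; apply: bf_inj => e; rewrite -(rowK e).
have tT' : 0 < t <= T by rewrite t0 ltW.
rewrite source_pairing//.
have [_ /(_ (wcomb psi (fun k => e ord0 k)) (ex_intro2 _ _ _ I erefl)) <-] :=
  h t tT'.
rewrite bf_row ip_row ip_div.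
by rewrite !bfDl !bfZl -!bf_dot /curve /dcurve; ring.
Qed.

(** The pressure solves the reduced system; the displacement is alpha times
    its product with S, plus a constant s with s A = l. *)
Lemma biot_exists (u0 : 'I_n -> R) :
  exists (us : c1curve T n) (ps : c1curve T m),
  [/\ biot_solution Omega P phi psi f us ps, forall k, coef ps k 0 = p0 k &
      compatible_initial Omega P phi psi u0 p0 -> forall k, coef us k 0 = u0 k].
Proof.
have [Q [h [cQ ch dQ Q0 hQ]]] : exists Q h, solves Q h.
  apply: (@solution_exists _ T m T0 M B coupling_mx b L Ms Mge0
    mass_mx_definite Bs Bge0
    coupling_mx_sym coupling_mx_ge0 coupling_mx_le b_gt0 L_gt0
    (fun i => curve (p i.+1)) (fun i => dcurve (p i.+1))
    source).
  - by move=> i; exact: vcont_curve.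
  - by move=> i; exact: vcont_dcurve.
  - by move=> i; exact: vderiv_curve.
  - exact: (@vcont_flow 0).
  - exact: init_row.
  - by move=> i t; apply: reduced_step; exact: iterate_coupled.
have [s [sA s0]] : exists s : 'rV[R]_n, s *m A = l /\
    (compatible_initial Omega P phi psi u0 p0 ->
     s = (\row_k u0 k) - a *: ((\row_k p0 k) *m S)).
  (* when A is singular, s is determined only up to the kernel of A: it is
     chosen to match u0 whenever that is possible *)
  have [hc|nc] := pselect (compatible_initial Omega P phi psi u0 p0).
    exists ((\row_k u0 k) - a *: ((\row_k p0 k) *m S)); split => //.
    rewrite mulmxBl -scalemxAl -mulmxA SA; apply: bf_inj => v.
    have := hc (vcomb phi (fun k => v ord0 k)) (ex_intro2 _ _ _ I erefl).
    rewrite af_row ipC ip_div hl rowK => <-.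
    by rewrite bfBl bfZl -!bf_dot [bf C^T _ _]bf_tr.
  exists (curve (u 1%N) T - a *: (curve (p 1%N) T *m S)); split => //.
  rewrite mulmxBl -scalemxAl -mulmxA SA (mechanics_row (@iterate_mechanics 0)).
    by rewrite addrAC subrr add0r.
  by rewrite lexx ltW.
have cs y : vcont T (fun=> y : 'rV[R]_n) by exact: vcont_cst.
have cQS : vcont T (fun t => Q t *m (a *: S)) by exact: vcont_mulmx.
have chS : vcont T (fun t => h t *m (a *: S)) by exact: vcont_mulmx.
have ds : vderiv T (fun=> - s) (fun=> 0) by exact: vderiv_cst.
have dQS : vderiv T (fun t => Q t *m (a *: S)) (fun t => h t *m (a *: S))
  by exact: vderiv_mulmx.
have [us usE dusE] := curve_of (vcontB cQS (cs (- s))) (vcontB chS (cs 0))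
  (vderivB dQS ds).
have [ps psE dpsE] := curve_of cQ ch dQ.
have us_mech t : curve us t *m A = a *: (curve ps t *m C^T) + l.
  by rewrite usE psE opprK mulmxDl sA -scalemxAr -scalemxAl -mulmxA SA.
exists us, ps; split.
- move=> t tT; split=> _ [c _ <-].
    rewrite af_row ipC ip_div hl.
    have /(congr1 (fun r => bf 1%:M r (\row_k c k))) := us_mech t.
    by rewrite bfDl bfZl -!bf_dot [bf C^T _ _]bf_tr /curve => ->;
      rewrite addrAC subrr add0r.
  have tT' : 0 <= t <= T by case/andP: tT => t0 ->; rewrite ltW.
  rewrite bf_row ip_row ip_div.
  rewrite -source_pairing// -(hQ t tT') -psE -dpsE.
  have -> : dcurve ps t *m coupling_mx = a *: (dcurve us t *m C).
    by rewrite dusE dpsE subr0 -mulmxA -scalemxAl scalemxAr scalerA -expr2.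
  by rewrite !bfDl !bfZl -!bf_dot /curve /dcurve; ring.
- move=> k; have /(congr1 (fun v : R -> 'rV[R]_m => v 0 ord0 k)) := psE.
  by rewrite Q0 !mxE.
- move=> /s0 sE k; have /(congr1 (fun v : R -> 'rV[R]_n => v 0 ord0 k)) := usE.
  by rewrite Q0 opprK sE -scalemxAr addrC subrK !mxE.
Qed.

Section convergence.
Variables (us : c1curve T n) (ps : c1curve T m).
Hypotheses (hs : biot_solution Omega P phi psi f us ps)
  (ps0 : forall k, coef ps k 0 = p0 k).

(* errors of the i-th pressure, displacement, and of their derivatives *)
Let ep i t := curve (p i) t - curve ps t.
Let dep i t := dcurve (p i) t - dcurve ps t.
Let eu i t := curve (u i) t - curve us t.
Let deu i t := dcurve (u i) t - dcurve us t.
Let X i := energy T M (dep i).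

Lemma velocity_error_decay i : X i.+1 <= rate b L ^+ i * X 1.
Proof.
apply: (@error_decay _ T m T0 M B coupling_mx b L Ms Mge0 Bs Bge0
    coupling_mx_sym coupling_mx_ge0 coupling_mx_le b_gt0 L_gt0
    (fun i => curve (p i.+1)) (fun i => dcurve (p i.+1))
    source (\row_k p0 k)).
- by move=> j; exact: vcont_curve.
- by move=> j; exact: vcont_dcurve.
- by move=> j; exact: vderiv_curve.
- exact: init_row.
- by move=> j t; apply: reduced_step; exact: iterate_coupled.
- exact: (biot_solves hs ps0).
Qed.

Lemma pressure_error i t : 0 <= t <= T ->
  bf M (ep i.+1 t) (ep i.+1 t) <= T * X i.+1.
Proof.
apply: (@velocity_bound _ T m T0 M Ms Mge0 (ep i.+1) (dep i.+1)).
- by apply: vcontB; exact: vcont_curve.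
- by apply: vcontB; exact: vcont_dcurve.
- by apply: vderivB; exact: vderiv_curve.
- by apply/rowP => k; rewrite /ep init_row !mxE ps0 subrr.
Qed.

Lemma displacement_error i t : 0 <= t <= T ->
  bf A (eu i.+1 t) (eu i.+1 t)
  <= a ^+ 2 / bulk P * bf M (ep i.+1 t) (ep i.+1 t).
Proof.
move=> tT; apply: (displacement_le K0 Age0 Mge0 coup).
rewrite !mulmxBl (mechanics_row (@iterate_mechanics i) tT).
rewrite (mechanics_row (biot_mechanics hs) tT) scalerBr.
by rewrite opprD addrACA subrr addr0.
Qed.

Lemma displacement_rate_error i t : 0 <= t <= T ->
  bf A (deu i.+1 t) (deu i.+1 t)
  <= a ^+ 2 / bulk P * bf M (dep i.+1 t) (dep i.+1 t).
Proof.
move=> tT; apply: (displacement_le K0 Age0 Mge0 coup).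
rewrite !mulmxBl (mechanics_rate_row (@iterate_mechanics i) tT).
by rewrite (mechanics_rate_row (biot_mechanics hs) tT) scalerBr.
Qed.

(** Every quantity in the definition of convergence is at most a constant times
    X i, which decays geometrically. *)
Lemma splitting_converges : converges_to Omega P phi psi u p us ps.
Proof.
move=> eps e0.
have [N1 hN1] := H1sq_wcomb mO psi_L2grad.
have [N2 hN2] := H1sqv_vcomb mO phi_L2grad.
have [C1 C10 hC1] := pd_bf_le Ms Mge0 mass_mx_definite N1.
have [C2 C20 hC2] : exists2 C2 : R, 0 <= C2 &
    (forall v, bf A v v = 0 -> v = 0) ->
    forall v, bf N2 v v <= C2 * bf A v v.
  have [hA|hA] := pselect (forall v, bf A v v = 0 -> v = 0); last by exists 0.
  by have [C2 C20 hC2] := pd_bf_le As Age0 hA N2; exists C2.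
pose D := a ^+ 2 / bulk P.
have D0 : 0 <= D by rewrite divr_ge0 ?sqr_ge0// ltW.
have T0' : 0 <= T by exact: ltW.
have TT : 0 <= T <= T by rewrite T0' lexx.
(* dominates the constants of all the estimates below *)
pose Z := 1 + C1 * T + D * T + D + C2 * (D * T) + C2 * D.
have [z1 z2 z3 z4] : [/\ 0 <= C1 * T, 0 <= D * T, 0 <= C2 * (D * T) &
    0 <= C2 * D].
  have z2 : 0 <= D * T by exact: mulr_ge0.
  by split; exact: mulr_ge0.
have Xge0 i : 0 <= X i by exact: energy_ge0.
have [k _ hk] : \forall i \near \oo, Z * (rate b L ^+ i * X 1) <= eps.
  have : (fun i => Z * (rate b L ^+ i * X 1)) @ \oo --> Z * (0 * X 1).
    apply: cvgM; first exact: cvg_cst.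
    apply: cvgM; last exact: cvg_cst.
    by apply: cvg_expr; rewrite ger0_norm ?rate_ge0 ?rate_lt1 ?b_gt0 ?L_gt0.
  rewrite mul0r mulr0 => /cvgrPdist_le/(_ _ e0); apply: filterS => i.
  by rewrite sub0r normrN; apply: le_trans; exact: ler_norm.
(* the estimates hold from the first iterate on, the guess being arbitrary *)
exists k.+1 => // -[//|i] /= ki.
have small y c : 0 <= c -> c <= Z -> y <= c * X i.+1 -> y <= eps.
  move=> c0 cZ /le_trans; apply.
  have := hk i ki; apply: le_trans; apply: ler_pM => //;
    exact: velocity_error_decay.
have Pe (c e : 'I_m -> R) : (\row_k (c k - e k)) = (\row_k c k) - (\row_k e k).
  by apply/rowP => j; rewrite !mxE.
have Ue (c e : 'I_n -> R) : (\row_k (c k - e k)) = (\row_k c k) - (\row_k e k).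
  by apply/rowP => j; rewrite !mxE.
have cdeu : vcont T (deu i.+1) by apply: vcontB; exact: vcont_dcurve.
have cdep : vcont T (dep i.+1) by apply: vcontB; exact: vcont_dcurve.
have cA : tcont T (fun s => bf A (deu i.+1 s) (deu i.+1 s)) by exact: tcont_bf.
have cM : tcont T (fun s => bf M (dep i.+1 s) (dep i.+1 s)) by exact: tcont_bf.
have dA : time_int T (fun s => bf A (deu i.+1 s) (deu i.+1 s)) <= D * X i.+1.
  rewrite /X /energy -(time_intZ _ TT cM); apply: (time_int_le TT cA);
    first exact: tcontZ.
  by move=> s sT; exact: displacement_rate_error.
have eA t : 0 <= t <= T -> bf A (eu i.+1 t) (eu i.+1 t) <= D * T * X i.+1.
  move=> tT; apply: le_trans (displacement_error i tT) _.
  by rewrite -/D -[leRHS]mulrA ler_wpM2l// pressure_error.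
split.
- move=> t tT; apply: (small _ (C1 * T)) => //; first by rewrite /Z; lra.
  rewrite wsub_wcomb hN1 Pe; apply: le_trans (hC1 _) _.
  by rewrite -[leRHS]mulrA ler_wpM2l// pressure_error.
- apply: (small _ 1) => //; first by rewrite /Z; lra.
  rewrite mul1r /X /energy le_eqVlt; apply/orP; left; apply/eqP; congr time_int.
  by apply/funext => s; rewrite /L2sq wsub_wcomb ip_row Pe.
- move=> t tT; apply: (small _ (D * T)) => //; first by rewrite /Z; lra.
  by rewrite vsub_vcomb af_row Ue eA.
- apply: (small _ D) => //; first by rewrite /Z; lra.
  apply: le_trans dA; rewrite le_eqVlt; apply/orP; left; apply/eqP;
    congr time_int.
  by apply/funext => s; rewrite vsub_vcomb af_row Ue.
- move=> hdef; have hA v : bf A v v = 0 -> v = 0.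
    rewrite -{1 2}(rowK v) -af_row => /hdef h.
    by apply/rowP => j; rewrite h mxE.
  split.
    move=> t tT; apply: (small _ (C2 * (D * T))) => //; first by rewrite /Z;
      lra.
    rewrite vsub_vcomb hN2 Ue; apply: le_trans (hC2 hA _) _.
    by rewrite -[leRHS]mulrA ler_wpM2l// eA.
  apply: (small _ (C2 * D)) => //; first by rewrite /Z; lra.
  apply: le_trans (_ : C2 * time_int T
    (fun s => bf A (deu i.+1 s) (deu i.+1 s)) <= _).
    rewrite -(time_intZ _ TT cA).
    rewrite (_ : (fun s => H1sqv _ _)
      = fun s => bf N2 (deu i.+1 s) (deu i.+1 s)).
      by apply: (time_int_le TT) => [||s _];
        [exact: tcont_bf|exact: tcontZ|exact: hC2].
    by apply/funext => s; rewrite vsub_vcomb hN2 Ue.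
  by rewrite -mulrA ler_wpM2l.
Qed.

End convergence.
End splitting.

Theorem theorem1 (R : realType) (d : nat) (hd : (0 < d <= 3)%N)
    (Omega Gt Gc : set 'rV[R]_d)
    (hOmega : open Omega) (hOmega_bd : bounded_set Omega)
    (hOmega_reg : lipschitz_boundary Omega)
    (hGamma : bdry Omega = Gt `|` Gc) (hGamma_disj : Gt `&` Gc = set0)
    (hGt : (0 < hausdorff d.-1 Gt)%E) (hGc : (0 < hausdorff d.-1 Gc)%E)
    (P : biot_params R d) (hP : admissible Omega P)
    (T : R) (hT : 0 < T)
    (n m : nat) (phi : 'I_n -> @vfun R d) (psi : 'I_m -> @wfun R d)
    (hphi : basis_in_V Omega Gc phi) (hpsi : basis_in_Q Omega Gt psi)
    (f : R -> 'rV[R]_d -> R) (hf : forall t, 0 < t <= T -> L2 Omega (f t))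
    (u0 : 'I_n -> R) (p0 : 'I_m -> R)
    (L : R)
    (hL : alpha P ^+ 2 / (2 * (2 * shear P / d%:R + lame P)) <= L)
    (u : nat -> c1curve T n) (p : nat -> c1curve T m)
    (hup : fixed_stress Omega P phi psi f L p0 u p) :
  (exists (us : c1curve T n) (ps : c1curve T m),
     [/\ biot_solution Omega P phi psi f us ps,
         forall k, coef ps k 0 = p0 k &
         compatible_initial Omega P phi psi u0 p0 ->
         forall k, coef us k 0 = u0 k]) /\
  (forall (us : c1curve T n) (ps : c1curve T m),
     biot_solution Omega P phi psi f us ps ->
     (forall k, coef ps k 0 = p0 k) ->
     converges_to Omega P phi psi u p us ps) /\
  (forall i : nat, (2 <= i)%N ->
     (consistent_guess Omega P phi psi (u 0%N) (p 0%N) \/ (2 < i)%N) ->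
     forall t, 0 < t <= T ->
     time_int t (fun s => L2sq Omega (dt_delta psi p i s))
     <= L / ((beta P)^-1 + L) *
        time_int t (fun s => L2sq Omega (dt_delta psi p i.-1 s))).

Proof.
have d0 : (0 < d)%N by case/andP: hd.
have mO := open_measurable_rV hOmega.
have Lphi := phi_L2grad hphi; have Lpsi := psi_L2grad hpsi.
have [S SA] := schur_factor (bulk_gt0 hP d0) (stiff_mx_sym P mO Lphi)
  (coupling_bound mO hP d0 Lphi Lpsi).
have [l hl] := load_row mO hT hphi hpsi hup.
split; last split.
- exact: (biot_exists d0 mO hP hT hphi hpsi hL hup SA hl u0).
- move=> us ps hs ps0.
  exact: (splitting_converges d0 mO hP hT hphi hpsi hL hup SA hl hs ps0).
case=> [|[|i]]// _ hi t /andP[t0 tT].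
have E j : time_int t (fun s => L2sq Omega (dt_delta psi p j.+1 s))
    = time_int t (fun s => bf (mass_mx Omega psi)
      (dcurve (p j.+1) s - dcurve (p j) s)
                                  (dcurve (p j.+1) s - dcurve (p j) s)).
  congr time_int; apply/funext => s.
  rewrite /L2sq /dt_delta wsub_wcomb (ip_wcomb mO Lpsi).
  by congr bf; apply/rowP => k; rewrite !mxE.
rewrite !E; apply: (increment_contracts d0 mO hP hT hphi hpsi hL hup SA hl).
  (* only the guess itself, i = 0, may fail the mechanics equation *)
  case: i hi => [[hc|//]|i _].
    exact: (guess_coupled d0 mO hP hT hphi hpsi SA).
  exact: (iterate_coupled d0 mO hP hT hphi hpsi hup SA hl).
by rewrite ltW.
Qed.
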